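(* Let $n\ge 1$. The assignment $\mathfrak{u}_i\mapsto U_i$ ($0\le i\le n-1$) extends to a monoid isomorphism from the diagrammatic blob monoid $\mathfrak{Bl}_n$ onto the Motzkin blob monoid $\mathfrak{M}_n^{(1)}$.
   Context: TL-diagrams and blobbed TL-diagrams: place top points $1,\dots,n$ at $(1,1),\dots,(n,1)$ and bottom points $1',\dots,n'$ at $(1,0),\dots,(n,0)$ in the strip $\mathbb{R}\times[0,1]$; a TL-diagram is a set of $n$ pairwise disjoint arcs in the strip pairing these $2n$ points, up to isotopy (a non-crossing perfect matching). The left side is the unbounded region of the complement of the arcs containing points $(x,1/2)$ with $x$ very negative; an arc is exposed to the left side if it lies on the boundary of that region. A blobbed TL-diagram is a TL-diagram in which some left-exposed arcs carry one blob each (other arcs carry none). $\mathfrak{Bl}_n$ is the set of blobbed TL-diagrams on $n$ points with product $D\cdot D'$: place $D$ above $D'$, identify the bottom of $D$ with the top of $D'$, delete closed loops, and give each resulting arc exactly one blob if some constituent piece carried a blob, none otherwise. $\mathfrak{u}_0$ is the identity diagram with a blob on the arc $\{1,1'\}$; for $1\le i\le n-1$, $\mathfrak{u}_i$ is the unblobbed diagram with arcs $\{i,i+1\}$, $\{i',(i+1)'\}$, $\{k,k'\}$ ($k\ne i,i+1$). The partition monoid $\mathfrak{C}_n$ consists of all set partitions of $[1,n]\cup[1',n']$; the product $\alpha\beta$ is formed by stacking $\alpha$ above $\beta$ (identifying the primed points of $\alpha$ with the unprimed points of $\beta$ as a middle row), taking connected components of the resulting graph, and keeping as blocks their nonempty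 intersections with the top row of $\alpha$ and bottom row of $\beta$ (components lying entirely in the middle row are discarded). Define $U_0\in\mathfrak{C}_n$ with blocks $\{1\},\{1'\}$ and $\{k,k'\}$ for $2\le k\le n$, and for $1\le i\le n-1$, $U_i$ with blocks $\{i,i+1\}$, $\{i',(i+1)'\}$ and $\{k,k'\}$ for $k\notin\{i,i+1\}$. The Motzkin blob monoid $\mathfrak{M}_n^{(1)}$ is the submonoid of $\mathfrak{C}_n$ generated by $U_0,\dots,U_{n-1}$. *)

(* Defs.v *)
From HB Require Import structures.
From mathcomp Require Import all_boot.
From mathcomp Require Import zify.

Set Implicit Arguments.
Unset Strict Implicit.
Unset Printing Implicit Defensive.

(* Points are numbered from 0: [inl i] is the top point [i+1] and [inr i] is
   the bottom point [(i+1)']. *)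
Notation pt n := ('I_n + 'I_n)%type.

(* The three rows (top, middle, bottom) of two stacked diagrams; [inl] embeds
   the points of the upper diagram. *)
Notation stk n := ('I_n + 'I_n + 'I_n)%type.

Section Definitions.
Variable n : nat.
Implicit Types (P Q D : {set {set pt n}}) (A B : {set pt n}).

Definition upper (x : pt n) : stk n := inl x.

Definition lower (x : pt n) : stk n :=
  match x with inl i => inl (inr i) | inr i => inr i end.

Definition outer (x : pt n) : stk n :=
  match x with inl i => inl (inl i) | inr i => inr i end.

Definition stack_edge P Q : rel (stk n) := fun x y =>
  [exists A in P, (x \in upper @: A) && (y \in upper @: A)]
  || [exists B in Q, (x \in lower @: B) && (y \in lower @: B)].

Definition component P Q (x : stk n) : {set stk n} :=
  [set y | connect (stack_edge P Q) x y].

Definition components P Q : {set {set stk n}} :=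
  [set component P Q x | x : stk n].

Definition stack P Q : {set {set pt n}} :=
  [set outer @^-1: C | C : {set stk n} in components P Q] :\ set0.

Definition stack_blobs P Q (bP bQ : {set {set pt n}}) : {set {set pt n}} :=
  [set outer @^-1: C | C : {set stk n} in components P Q &
     [exists A in bP, upper @: A \subset C]
     || [exists B in bQ, lower @: B \subset C]] :\ set0.

(* Rank of a point along the boundary of the strip, read from the left end:
   1, ..., n, n', ..., 1'. *)
Definition pos (x : pt n) : nat :=
  match x with inl i => i | inr i => n + rev_ord i end.

Definition noncrossing D : bool :=
  [forall A in D, forall B in D,
   forall a in A, forall c in A, forall b in B, forall d in B,
     [&& pos a < pos b, pos b < pos c & pos c < pos d] ==> (A == B)].

(* An arc with endpoints of ranks [p < q] cuts the boundary points of rank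
   strictly between [p] and [q] off from the left side. Hence the arc [A] lies
   on the boundary of the left region iff no arc of [D] cuts off an endpoint
   of [A]. *)
Definition exposed D A : bool :=
  [forall B in D, forall b in B, forall d in B, forall a in A,
     ~~ ((pos b < pos a) && (pos a < pos d))].

Definition TL_diagram D : bool :=
  [&& partition D [set: pt n], [forall A in D, #|A| == 2] & noncrossing D].

Definition blobbed_TL (X : {set {set pt n}} * {set {set pt n}}) : bool :=
  [&& TL_diagram X.1, X.2 \subset X.1 & [forall A in X.2, exposed X.1 A]].

Record partition_monoid := PartitionMonoid {
  blocks :> {set {set pt n}};
  _ : partition blocks [set: pt n]
}.

Record blob_monoid := BlobMonoid {
  arcs_blobs :> {set {set pt n}} * {set {set pt n}};
  _ : blobbed_TL arcs_blobs
}.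

Definition id_diagram : {set {set pt n}} :=
  [set [set inl k; inr k] | k : 'I_n].

Definition prev (i : 'I_n) : 'I_n :=
  Ordinal (leq_ltn_trans (leq_pred i) (ltn_ord i)).

(* The generator of index [i >= 1] joins the points usually called [i], [i+1];
   with the numbering from 0 these are [prev i] and [i]. *)
Definition hook (i : 'I_n) : {set {set pt n}} :=
  [set [set inl (prev i); inl i]; [set inr (prev i); inr i]]
  :|: [set [set inl k; inr k] | k : 'I_n & (k != prev i) && (k != i)].

Definition cut (i : 'I_n) : {set {set pt n}} :=
  [set [set inl i]; [set inr i]]
  :|: [set [set inl k; inr k] | k : 'I_n & k != i].

Definition motzkin_gen_blocks (i : 'I_n) : {set {set pt n}} :=
  if i == 0 :> nat then cut i else hook i.

Definition blob_gen_diagram (i : 'I_n) :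
    {set {set pt n}} * {set {set pt n}} :=
  if i == 0 :> nat then (id_diagram, [set [set inl i; inr i]])
  else (hook i, set0).

End Definitions.

Arguments upper {n} x.
Arguments lower {n} x.
Arguments outer {n} x.

HB.instance Definition _ n := [isSub for @blocks n].
HB.instance Definition _ n := [Finite of partition_monoid n by <:].
HB.instance Definition _ n := [isSub for @arcs_blobs n].
HB.instance Definition _ n := [Finite of blob_monoid n by <:].

Lemma partitionT_intro (T : finType) (P : {set {set T}}) :
  set0 \notin P -> (forall x, exists2 A, A \in P & x \in A) ->
  (forall (A B : {set T}) x, A \in P -> B \in P -> x \in A -> x \in B -> A = B) ->
  partition P [set: T].
Proof.
move=> P0 Pc Pd; apply/and3P; split=> //.
  apply/eqP/setP=> x; rewrite inE; have [A AP xA] := Pc x.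
  by apply/bigcupP; exists A.
apply/trivIsetP=> A B AP BP; apply: contraR.
case/pred0Pn=> x /andP[xA xB]; apply/eqP; exact: (Pd A B x).
Qed.

Lemma partT_in (T : finType) (P : {set {set T}}) x :
  partition P [set: T] -> x \in pblock P x /\ pblock P x \in P.
Proof.
move=> pP; have xc : x \in cover P by rewrite (cover_partition pP) inE.
by rewrite mem_pblock xc pblock_mem.
Qed.

Lemma partT_eq (T : finType) (P : {set {set T}}) (A : {set T}) x :
  partition P [set: T] -> A \in P -> x \in A -> pblock P x = A.
Proof. by move=> /partition_trivIset tP AP xA; apply: def_pblock. Qed.

Lemma partT_ext (T : finType) (P Q : {set {set T}}) :
  partition P [set: T] -> partition Q [set: T] ->
  (forall x y, (y \in pblock P x) = (y \in pblock Q x)) -> P = Q.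
Proof.
move=> pP pQ E.
have sub P1 Q1 : partition P1 [set: T] -> partition Q1 [set: T] ->
  (forall x y, (y \in pblock P1 x) = (y \in pblock Q1 x)) -> P1 \subset Q1.
  move=> pP1 pQ1 E1; apply/subsetP=> A AP.
  have /set0Pn[x xA] : A != set0 by apply: contraTneq AP => ->; case/and3P: pP1.
  rewrite -(partT_eq pP1 AP xA).
  have -> : pblock P1 x = pblock Q1 x by apply/setP=> y.
  by case: (partT_in x pQ1).
by apply/eqP; rewrite eqEsubset !sub.
Qed.

Section Stacking.
Variable n : nat.
Implicit Types (P Q R D bP bQ bR : {set {set pt n}}) (A B : {set pt n}) (a b : pt n).

Lemma stack_edgeP P Q x y : partition P [set: pt n] -> partition Q [set: pt n] ->
  reflect ((exists a b, [/\ x = upper a, y = upper b & b \in pblock P a]) \/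
           (exists a b, [/\ x = lower a, y = lower b & b \in pblock Q a]))
          (stack_edge P Q x y).
Proof.
move=> pP pQ; apply: (iffP orP).
  move=> [/exists_inP[A AP /andP[/imsetP[a aA ->] /imsetP[b bA ->]]] |
          /exists_inP[A AP /andP[/imsetP[a aA ->] /imsetP[b bA ->]]]];
   [left | right]; exists a, b; split=> //.
   by rewrite (partT_eq pP AP aA).
  by rewrite (partT_eq pQ AP aA).
move=> [[a [b [-> -> ab]]]|[a [b [-> -> ab]]]]; [left | right].
  have [aa aP] := partT_in a pP; apply/exists_inP; exists (pblock P a) => //.
  by rewrite !imset_f.
have [aa aP] := partT_in a pQ; apply/exists_inP; exists (pblock Q a) => //.
by rewrite !imset_f.
Qed.

Lemma stack_edge_sym P Q : connect_sym (stack_edge P Q).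
Proof.
apply: sym_connect_sym => x y; rewrite /stack_edge; congr (_ || _);
  by apply: eq_existsb => A; rewrite [X in _ && X]andbC.
Qed.

Lemma stack_edge_upper P Q a b : partition P [set: pt n] ->
  b \in pblock P a -> connect (stack_edge P Q) (upper a) (upper b).
Proof.
move=> pP ab; apply/connect1/orP; left; apply/exists_inP.
by exists (pblock P a); [case: (partT_in a pP) | rewrite !imset_f //; case: (partT_in a pP)].
Qed.

Lemma stack_edge_lower P Q a b : partition Q [set: pt n] ->
  b \in pblock Q a -> connect (stack_edge P Q) (lower a) (lower b).
Proof.
move=> pQ ab; apply/connect1/orP; right; apply/exists_inP.
by exists (pblock Q a); [case: (partT_in a pQ) | rewrite !imset_f //; case: (partT_in a pQ)].
Qed.

Lemma componentE P Q x y : (y \in component P Q x) = connect (stack_edge P Q) x y.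
Proof. by rewrite inE. Qed.

Lemma mem_stack P Q a : outer @^-1: component P Q (outer a) \in stack P Q.
Proof.
rewrite !inE; apply/andP; split.
  by apply/set0Pn; exists a; rewrite !inE connect0.
by apply: imset_f; apply: imset_f.
Qed.

Lemma stackP P Q A a : A \in stack P Q -> a \in A ->
  A = outer @^-1: component P Q (outer a).
Proof.
rewrite inE => /andP[_ /imsetP[C /imsetP[x _ ->] ->]]; rewrite !inE => xa.
apply/setP=> b; rewrite !inE; exact: same_connect (stack_edge_sym P Q) _ _ xa _.
Qed.

Lemma stack_partition P Q : partition (stack P Q) [set: pt n].
Proof.
apply: partitionT_intro; first by rewrite !inE eqxx.
  by move=> a; exists (outer @^-1: component P Q (outer a));
     rewrite ?mem_stack // !inE connect0.
by move=> A B a AP BP aA aB; rewrite (stackP AP aA) (stackP BP aB).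
Qed.

Lemma pblock_stack P Q a : pblock (stack P Q) a = outer @^-1: component P Q (outer a).
Proof.
apply: partT_eq (stack_partition P Q) (mem_stack P Q a) _.
by rewrite !inE connect0.
Qed.

Lemma in_pblock_stack P Q a b :
  (b \in pblock (stack P Q) a) = connect (stack_edge P Q) (outer a) (outer b).
Proof. by rewrite pblock_stack !inE. Qed.

Lemma stack_blobs_sub P Q bP bQ : stack_blobs P Q bP bQ \subset stack P Q.
Proof.
apply: setSD; apply/subsetP=> A /imsetP[C].
by rewrite inE => /andP[CC _] ->; apply: imset_f.
Qed.

Lemma mem_stack_blobsP P Q bP bQ A a : A \in stack P Q -> a \in A ->
  partition P [set: pt n] -> partition Q [set: pt n] ->
  bP \subset P -> bQ \subset Q ->
  reflect ((exists2 c, c \in cover bP & connect (stack_edge P Q) (outer a) (upper c)) \/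
           (exists2 c, c \in cover bQ & connect (stack_edge P Q) (outer a) (lower c)))
          (A \in stack_blobs P Q bP bQ).
Proof.
move=> AS aA pP pQ sP sQ; apply: (iffP idP).
  rewrite inE => /andP[_ /imsetP[C]]; rewrite inE => /andP[/imsetP[x _ ->{C}] H] E.
  move: aA; rewrite E !inE stack_edge_sym => ax.
  case/orP: H => /exists_inP[B Bb sB]; [left | right].
    have BP := subsetP sP _ Bb.
    have /set0Pn[c cB] : B != set0 by apply: contraTneq BP => ->; case/and3P: pP.
    exists c; first by apply/bigcupP; exists B.
    apply: connect_trans ax _; rewrite -componentE.
    by apply: (subsetP sB); apply: imset_f.
  have BQ := subsetP sQ _ Bb.
  have /set0Pn[c cB] : B != set0 by apply: contraTneq BQ => ->; case/and3P: pQ.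
  exists c; first by apply/bigcupP; exists B.
  apply: connect_trans ax _; rewrite -componentE.
  by apply: (subsetP sB); apply: imset_f.
move=> H; rewrite inE; apply/andP; split.
  by rewrite inE; apply/set0Pn; exists a.
rewrite (stackP AS aA); apply: imset_f; rewrite inE imset_f //=; apply/orP.
case: H => [[c /bigcupP[B Bb cB] ac]|[c /bigcupP[B Bb cB] ac]]; [left | right];
  apply/exists_inP; exists B => //; apply/subsetP=> _ /imsetP[d dB ->];
  rewrite componentE; apply: connect_trans ac _.
  by apply: stack_edge_upper; rewrite // (partT_eq pP (subsetP sP _ Bb) cB).
by apply: stack_edge_lower; rewrite // (partT_eq pQ (subsetP sQ _ Bb) cB).
Qed.

Lemma mem_cover_blobsP P Q bP bQ a :
  partition P [set: pt n] -> partition Q [set: pt n] ->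
  bP \subset P -> bQ \subset Q ->
  reflect ((exists2 c, c \in cover bP & connect (stack_edge P Q) (outer a) (upper c)) \/
           (exists2 c, c \in cover bQ & connect (stack_edge P Q) (outer a) (lower c)))
          (a \in cover (stack_blobs P Q bP bQ)).
Proof.
move=> pP pQ sP sQ; apply: (iffP bigcupP).
  move=> [A Ab aA].
  have AS := subsetP (stack_blobs_sub P Q bP bQ) _ Ab.
  exact/(mem_stack_blobsP AS aA pP pQ sP sQ).
move=> H; have aA : a \in outer @^-1: component P Q (outer a).
  by rewrite !inE connect0.
exists (outer @^-1: component P Q (outer a)) => //.
exact/(mem_stack_blobsP (mem_stack P Q a) aA pP pQ sP sQ).
Qed.

Lemma blobs_ext P bP bQ : partition P [set: pt n] ->
  bP \subset P -> bQ \subset P -> cover bP =i cover bQ -> bP = bQ.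
Proof.
move=> pP sP sQ E.
have sub (b1 b2 : {set {set pt n}}) : b1 \subset P -> b2 \subset P ->
   cover b1 =i cover b2 -> b1 \subset b2.
  move=> s1 s2 E1; apply/subsetP=> A Ab; have AP := subsetP s1 _ Ab.
  have /set0Pn[x xA] : A != set0 by apply: contraTneq AP => ->; case/and3P: pP.
  have : x \in cover b1 by apply/bigcupP; exists A.
  rewrite E1 => /bigcupP[B Bb xB].
  by rewrite -(partT_eq pP AP xA) (partT_eq pP (subsetP s2 _ Bb) xB).
by apply/eqP; rewrite eqEsubset; apply/andP; split; apply: sub => // x; rewrite E.
Qed.

End Stacking.

Section Associativity.

Section Abstract.
Variables (X T V S : finType) (e4 : rel T) (eV : rel V) (eS : rel S).
Variables (j : V -> T) (k : S -> T) (l : X -> V) (o : X -> S).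
Hypotheses (j_inj : injective j) (k_inj : injective k).
Hypothesis overlap : forall s v, k s = j v -> exists a, s = o a /\ v = l a.
Hypothesis kj : forall a, k (o a) = j (l a).
Hypothesis e4E : forall x y, e4 x y ->
  (exists s s', [/\ x = k s, y = k s' & eS s s']) \/
  (exists v v', [/\ x = j v, y = j v' & eV v v']).
Hypothesis eS4 : forall s s', eS s s' -> connect e4 (k s) (k s').
Hypothesis eV4 : forall v v', eV v v' -> connect e4 (j v) (j v') \/
  (exists a b, [/\ v = l a, v' = l b & connect eS (o a) (o b)]).
Hypothesis eSV : forall a b, connect eS (o a) (o b) -> connect eV (l a) (l b).

Lemma abs_S4 s s' : connect eS s s' -> connect e4 (k s) (k s').
Proof.
case/connectP=> p; elim: p s => [|x p IH] s /=; first by move=> _ ->; exact: connect0.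
by case/andP=> /eS4 sx /IH H /H; exact: connect_trans.
Qed.

Lemma abs_V4 v v' : connect eV v v' -> connect e4 (j v) (j v').
Proof.
case/connectP=> p; elim: p v => [|x p IH] v /=; first by move=> _ ->; exact: connect0.
case/andP=> vx /IH H /H; apply: connect_trans.
case: (eV4 vx) => // -[a [b [-> -> ab]]]; rewrite -!kj; exact: abs_S4.
Qed.

Lemma abs_inv v y : connect e4 (j v) y ->
  (forall w, y = j w -> connect eV v w) /\
  (forall s, y = k s -> exists2 a, connect eV v (l a) & connect eS (o a) s).
Proof.
case/connectP=> p; elim/last_ind: p y => [|p z IH] y /=.
  move=> _ ->; split=> [w /j_inj ->|s]; first exact: connect0.
  by move=> /esym /overlap[a [-> ->]]; exists a; exact: connect0.
rewrite rcons_path last_rcons => /andP[pp ez] ->.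
have [I1 I2] := IH _ pp erefl.
case: (e4E ez) => [[s [s' [Es -> ss']]]|[w [w' [Ew -> ww']]]].
  have [a va as_] := I2 _ Es.
  have as' := connect_trans as_ (connect1 ss').
  split=> [w /overlap[b [Eb ->]]|s2 /k_inj <-]; last by exists a.
  by apply: connect_trans va _; apply: eSV; rewrite -Eb.
have vw' := connect_trans (I1 _ Ew) (connect1 ww').
split=> [w2 /j_inj <- //|s /esym /overlap[b [-> Eb]]].
by exists b; rewrite -?Eb.
Qed.

Lemma abs_V v w : connect e4 (j v) (j w) = connect eV v w.
Proof. by apply/idP/idP => [/abs_inv[H _]|/abs_V4 //]; apply: H. Qed.

Lemma abs_S v s : connect e4 (j v) (k s) <->
  exists2 a, connect eV v (l a) & connect eS (o a) s.
Proof.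
split=> [/abs_inv[_ H]|[a va as_]]; first exact: H.
by apply: connect_trans (abs_V4 va) _; rewrite -kj; apply: abs_S4.
Qed.

End Abstract.

Variable n : nat.
Implicit Types (P Q R D bP bQ bR : {set {set pt n}}) (A B : {set pt n}) (a b : pt n).

Let T4 := ('I_n + 'I_n + 'I_n + 'I_n)%type.

Definition row01 (x : pt n) : T4 := inl (inl x).
Definition row12 (x : pt n) : T4 :=
  match x with inl i => inl (inl (inr i)) | inr i => inl (inr i) end.
Definition row23 (x : pt n) : T4 :=
  match x with inl i => inl (inr i) | inr i => inr i end.
Definition row012 (x : stk n) : T4 := inl x.
Definition row123 (x : stk n) : T4 :=
  match x with inl (inl i) => inl (inl (inr i)) | inl (inr i) => inl (inr i)
  | inr i => inr i end.
Definition row023 (x : stk n) : T4 :=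
  match x with inl (inl i) => inl (inl (inl i)) | inl (inr i) => inl (inr i)
  | inr i => inr i end.
Definition row013 (x : stk n) : T4 :=
  match x with inl (inl i) => inl (inl (inl i)) | inl (inr i) => inl (inl (inr i))
  | inr i => inr i end.

Definition edge4 P Q R : rel T4 := fun x y =>
  [|| [exists a, [exists b, [&& x == row01 a, y == row01 b & b \in pblock P a]]],
      [exists a, [exists b, [&& x == row12 a, y == row12 b & b \in pblock Q a]]]
    | [exists a, [exists b, [&& x == row23 a, y == row23 b & b \in pblock R a]]]].

Lemma edge4P P Q R x y : reflect
  [\/ exists a b, [/\ x = row01 a, y = row01 b & b \in pblock P a],
      exists a b, [/\ x = row12 a, y = row12 b & b \in pblock Q a]
    | exists a b, [/\ x = row23 a, y = row23 b & b \in pblock R a]]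
  (edge4 P Q R x y).
Proof.
apply: (iffP or3P) => [[]|[]].
- by move=> /existsP[a /existsP[b /and3P[/eqP-> /eqP-> ab]]]; constructor 1; exists a, b.
- by move=> /existsP[a /existsP[b /and3P[/eqP-> /eqP-> ab]]]; constructor 2; exists a, b.
- by move=> /existsP[a /existsP[b /and3P[/eqP-> /eqP-> ab]]]; constructor 3; exists a, b.
- move=> [a [b [-> -> ab]]]; constructor 1.
  by apply/existsP; exists a; apply/existsP; exists b; rewrite !eqxx.
- move=> [a [b [-> -> ab]]]; constructor 2.
  by apply/existsP; exists a; apply/existsP; exists b; rewrite !eqxx.
- move=> [a [b [-> -> ab]]]; constructor 3.
  by apply/existsP; exists a; apply/existsP; exists b; rewrite !eqxx.
Qed.

Section Three.
Variables P Q R : {set {set pt n}}.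
Hypotheses (pP : partition P [set: pt n]) (pQ : partition Q [set: pt n])
  (pR : partition R [set: pt n]).

Let e4 := edge4 P Q R.

Lemma e4_1 a b : b \in pblock P a -> connect e4 (row01 a) (row01 b).
Proof. by move=> ab; apply/connect1/edge4P; constructor 1; exists a, b. Qed.
Lemma e4_2 a b : b \in pblock Q a -> connect e4 (row12 a) (row12 b).
Proof. by move=> ab; apply/connect1/edge4P; constructor 2; exists a, b. Qed.
Lemma e4_3 a b : b \in pblock R a -> connect e4 (row23 a) (row23 b).
Proof. by move=> ab; apply/connect1/edge4P; constructor 3; exists a, b. Qed.

Lemma row012_inj : injective row012. Proof. by move=> x y []. Qed.
Lemma row123_inj : injective row123.
Proof. by move=> [[x|x]|x] [[y|y]|y] //= []->. Qed.
Lemma row023_inj : injective row023.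
Proof. by move=> [[x|x]|x] [[y|y]|y] //= []->. Qed.
Lemma row013_inj : injective row013.
Proof. by move=> [[x|x]|x] [[y|y]|y] //= []->. Qed.

Let eL := stack_edge (stack P Q) R.
Let eLS := stack_edge P Q.
Let eR := stack_edge P (stack Q R).
Let eRS := stack_edge Q R.

Lemma L1 s v : row012 s = row023 v -> exists a, s = outer a /\ v = upper a.
Proof.
case: v => [[i|i]|i] //= [->]; first by exists (inl i).
by exists (inr i).
Qed.
Lemma L2 a : row012 (outer a) = row023 (upper a). Proof. by case: a. Qed.
Lemma L3 x y : e4 x y ->
  (exists s s', [/\ x = row012 s, y = row012 s' & eLS s s']) \/
  (exists v v', [/\ x = row023 v, y = row023 v' & eL v v']).
Proof.
case/edge4P=> [[a [b [-> -> ab]]]|[a [b [-> -> ab]]]|[a [b [-> -> ab]]]].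
- left; exists (upper a), (upper b); split=> //.
  by apply/(stack_edgeP _ _ pP pQ); left; exists a, b.
- left; exists (lower a), (lower b); split; try by case: a ab; case: b.
  by apply/(stack_edgeP _ _ pP pQ); right; exists a, b.
- right; exists (lower a), (lower b); split; try by case: a ab; case: b.
  by apply/(stack_edgeP _ _ (stack_partition _ _) pR); right; exists a, b.
Qed.
Lemma L4 s s' : eLS s s' -> connect e4 (row012 s) (row012 s').
Proof.
case/(stack_edgeP _ _ pP pQ)=> [[a [b [-> -> ab]]]|[a [b [-> -> ab]]]].
  exact: e4_1.
by have := e4_2 ab; case: a {ab}; case: b.
Qed.
Lemma L5 v v' : eL v v' -> connect e4 (row023 v) (row023 v') \/
  (exists a b, [/\ v = upper a, v' = upper b & connect eLS (outer a) (outer b)]).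
Proof.
case/(stack_edgeP _ _ (stack_partition _ _) pR)=> [[a [b [-> -> ab]]]|[a [b [-> -> ab]]]].
  by right; exists a, b; split=> //; rewrite -in_pblock_stack.
by left; have := e4_3 ab; case: a {ab}; case: b.
Qed.
Lemma L6 a b : connect eLS (outer a) (outer b) -> connect eL (upper a) (upper b).
Proof.
by rewrite -in_pblock_stack => ab; apply: stack_edge_upper (stack_partition _ _) ab.
Qed.

Lemma R1 s v : row123 s = row013 v -> exists a, s = outer a /\ v = lower a.
Proof.
case: s => [[i|i]|i]; case: v => [[j|j]|j] //= [->]; first by exists (inl j).
by exists (inr j).
Qed.
Lemma R2 a : row123 (outer a) = row013 (lower a). Proof. by case: a. Qed.
Lemma R3 x y : e4 x y ->
  (exists s s', [/\ x = row123 s, y = row123 s' & eRS s s']) \/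
  (exists v v', [/\ x = row013 v, y = row013 v' & eR v v']).
Proof.
case/edge4P=> [[a [b [-> -> ab]]]|[a [b [-> -> ab]]]|[a [b [-> -> ab]]]].
- right; exists (upper a), (upper b); split; try by case: a ab; case: b.
  by apply/(stack_edgeP _ _ pP (stack_partition _ _)); left; exists a, b.
- left; exists (upper a), (upper b); split; try by case: a ab; case: b.
  by apply/(stack_edgeP _ _ pQ pR); left; exists a, b.
- left; exists (lower a), (lower b); split; try by case: a ab; case: b.
  by apply/(stack_edgeP _ _ pQ pR); right; exists a, b.
Qed.
Lemma R4 s s' : eRS s s' -> connect e4 (row123 s) (row123 s').
Proof.
case/(stack_edgeP _ _ pQ pR)=> [[a [b [-> -> ab]]]|[a [b [-> -> ab]]]].
  by have := e4_2 ab; case: a {ab}; case: b.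
by have := e4_3 ab; case: a {ab}; case: b.
Qed.
Lemma R5 v v' : eR v v' -> connect e4 (row013 v) (row013 v') \/
  (exists a b, [/\ v = lower a, v' = lower b & connect eRS (outer a) (outer b)]).
Proof.
case/(stack_edgeP _ _ pP (stack_partition _ _))=> [[a [b [-> -> ab]]]|[a [b [-> -> ab]]]].
  by left; have := e4_1 ab; case: a {ab}; case: b.
by right; exists a, b; split=> //; rewrite -in_pblock_stack.
Qed.
Lemma R6 a b : connect eRS (outer a) (outer b) -> connect eR (lower a) (lower b).
Proof.
by rewrite -in_pblock_stack => ab; apply: stack_edge_lower (stack_partition _ _) ab.
Qed.

Definition absLV := abs_V row023_inj row012_inj L1 L2 L3 L4 L5 L6.
Definition absLS := abs_S row023_inj row012_inj L1 L2 L3 L4 L5 L6.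
Definition absRV := abs_V row013_inj row123_inj R1 R2 R3 R4 R5 R6.
Definition absRS := abs_S row013_inj row123_inj R1 R2 R3 R4 R5 R6.

Lemma row_outer a : row023 (outer a) = row013 (outer a). Proof. by case: a. Qed.

Lemma stackA : stack P (stack Q R) = stack (stack P Q) R.
Proof.
apply: partT_ext; try exact: stack_partition.
by move=> a b; rewrite !in_pblock_stack -absLV -absRV !row_outer.
Qed.

Lemma stack_blobsA bP bQ bR : bP \subset P -> bQ \subset Q -> bR \subset R ->
  stack_blobs P (stack Q R) bP (stack_blobs Q R bQ bR) =
  stack_blobs (stack P Q) R (stack_blobs P Q bP bQ) bR.
Proof.
move=> sP sQ sR; apply: (@blobs_ext _ (stack P (stack Q R))).
- exact: stack_partition.
- exact: stack_blobs_sub.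
- by rewrite stackA; exact: stack_blobs_sub.
move=> a; pose A4 := row023 (outer a).
pose G := [\/ exists2 c, c \in cover bP & connect e4 A4 (row01 c),
  exists2 c, c \in cover bQ & connect e4 A4 (row12 c)
  | exists2 c, c \in cover bR & connect e4 A4 (row23 c)].
have r1 c : row013 (upper c) = row01 c by case: c.
have r2 c : row123 (upper c) = row12 c by case: c.
have r3 c : row123 (lower c) = row23 c by case: c.
have r5 c : row012 (lower c) = row12 c by case: c.
have r6 c : row023 (lower c) = row23 c by case: c.
have cL := mem_cover_blobsP a (stack_partition P Q) pR (stack_blobs_sub P Q bP bQ) sR.
have cR := mem_cover_blobsP a pP (stack_partition Q R) sP (stack_blobs_sub Q R bQ bR).
have cLS c := mem_cover_blobsP c pP pQ sP sQ.
have cRS c := mem_cover_blobsP c pQ pR sQ sR.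
have GL : G <-> (a \in cover (stack_blobs (stack P Q) R (stack_blobs P Q bP bQ) bR)).
  split=> [H|/cL[[c /cLS[[d db cd]|[d db cd]] ac]|[c cb ac]]].
  - apply/cL; case: H => [[c cb]|[c cb]|[c cb]].
    + move/absLS=> [d ad dc]; left; exists d => //; apply/cLS.
      by left; exists c.
    + rewrite -r5 => /absLS [d ad dc]; left; exists d => //; apply/cLS.
      by right; exists c.
    + by rewrite -r6 absLV => ac; right; exists c.
  - constructor 1; exists d => //; apply/absLS; by exists c.
  - constructor 2; exists d => //; rewrite -r5; apply/absLS; by exists c.
  - by constructor 3; exists c => //; rewrite -r6 absLV.
have GR : G <-> (a \in cover (stack_blobs P (stack Q R) bP (stack_blobs Q R bQ bR))).
  rewrite /G /A4 row_outer.
  split=> [H|/cR[[c cb ac]|[c /cRS[[d db cd]|[d db cd]] ac]]].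
  - apply/cR; case: H => [[c cb]|[c cb]|[c cb]].
    + by rewrite -r1 absRV => ac; left; exists c.
    + rewrite -r2 => /absRS [d ad dc]; right; exists d => //; apply/cRS.
      by left; exists c.
    + rewrite -r3 => /absRS [d ad dc]; right; exists d => //; apply/cRS.
      by right; exists c.
  - by constructor 1; exists c => //; rewrite -r1 absRV.
  - constructor 2; exists d => //; rewrite -r2; apply/absRS; by exists c.
  - constructor 3; exists d => //; rewrite -r3; apply/absRS; by exists c.
apply/idP/idP; first by move/(iffRL GR)/(iffLR GL).
by move/(iffRL GL)/(iffLR GR).
Qed.

End Three.
End Associativity.

Section Identity.
Variable n : nat.
Implicit Types (P Q D bP bQ : {set {set pt n}}) (A B : {set pt n}) (a b : pt n).

Definition idx a : 'I_n := match a with inl i => i | inr i => i end.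

Lemma id_blockP a k : (a \in [set inl k; inr k]) = (idx a == k).
Proof. by rewrite !inE; case: a => i; rewrite -sum_eqE /= ?orbF. Qed.

Lemma id_partition : partition (id_diagram n) [set: pt n].
Proof.
apply: partitionT_intro.
- apply/imsetP=> -[k _ E]; have := id_blockP (inl k) k.
  by rewrite -E inE /= eqxx.
- move=> a; exists [set inl (idx a); inr (idx a)]; first exact: imset_f.
  by rewrite id_blockP.
- move=> _ _ a /imsetP[k _ ->] /imsetP[l _ ->].
  by rewrite !id_blockP => /eqP-> /eqP->.
Qed.

Lemma pblock_id a b : (b \in pblock (id_diagram n) a) = (idx b == idx a).
Proof.
have E : pblock (id_diagram n) a = [set inl (idx a); inr (idx a)].
  by apply: partT_eq id_partition _ _; [exact: imset_f | rewrite id_blockP].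
by rewrite E id_blockP.
Qed.

Definition fold_up (x : stk n) : pt n :=
  match x with inl (inl i) => inl i | inl (inr i) => inl i | inr i => inr i end.
Definition fold_dn (x : stk n) : pt n :=
  match x with inl (inl i) => inl i | inl (inr i) => inr i | inr i => inr i end.

Lemma pblock_trans P a b c : partition P [set: pt n] ->
  b \in pblock P a -> c \in pblock P b -> c \in pblock P a.
Proof.
by move=> pP ab; have [_ H] := partT_in a pP; rewrite (partT_eq pP H ab).
Qed.

Lemma fold_up_conn P x y : partition P [set: pt n] ->
  connect (stack_edge (id_diagram n) P) x y = (fold_up y \in pblock P (fold_up x)).
Proof.
move=> pP; apply/idP/idP.
  case/connectP=> p; elim: p x => [|z p IH] x /=.
    by move=> _ ->; case: (partT_in (fold_up x) pP).
  case/andP=> xz /IH H /H; apply: pblock_trans => //.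
  case/(stack_edgeP _ _ id_partition pP): xz => [[a [b [-> -> ab]]]|[a [b [-> -> ab]]]].
    have -> : fold_up (upper a) = fold_up (upper b).
      by move: ab; rewrite pblock_id; case: a; case: b => i k /= /eqP->.
    by case: (partT_in (fold_up (upper b)) pP).
  by case: a ab; case: b.
move=> xy.
have lf z : connect (stack_edge (id_diagram n) P) z (lower (fold_up z)).
  case: z => [[i|i]|i] /=; try exact: connect0.
  apply: (@stack_edge_upper _ _ _ (inl i) (inr i)); first exact: id_partition.
  by rewrite pblock_id.
apply: connect_trans (lf x) _; rewrite stack_edge_sym.
apply: connect_trans (lf y) _; rewrite stack_edge_sym.
exact: stack_edge_lower.
Qed.

Lemma fold_dn_conn P x y : partition P [set: pt n] ->
  connect (stack_edge P (id_diagram n)) x y = (fold_dn y \in pblock P (fold_dn x)).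
Proof.
move=> pP; apply/idP/idP.
  case/connectP=> p; elim: p x => [|z p IH] x /=.
    by move=> _ ->; case: (partT_in (fold_dn x) pP).
  case/andP=> xz /IH H /H; apply: pblock_trans => //.
  case/(stack_edgeP _ _ pP id_partition): xz => [[a [b [-> -> ab]]]|[a [b [-> -> ab]]]].
    by case: a ab; case: b.
  have -> : fold_dn (lower a) = fold_dn (lower b).
    by move: ab; rewrite pblock_id; case: a; case: b => i k /= /eqP->.
  by case: (partT_in (fold_dn (lower b)) pP).
move=> xy.
have lf z : connect (stack_edge P (id_diagram n)) z (upper (fold_dn z)).
  case: z => [[i|i]|i] /=; try exact: connect0.
  apply: (@stack_edge_lower _ _ _ (inr i) (inl i)); first exact: id_partition.
  by rewrite pblock_id.
apply: connect_trans (lf x) _; rewrite stack_edge_sym.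
apply: connect_trans (lf y) _; rewrite stack_edge_sym.
exact: stack_edge_upper.
Qed.

Lemma stack1p P : partition P [set: pt n] -> stack (id_diagram n) P = P.
Proof.
move=> pP; apply: partT_ext => //; first exact: stack_partition.
by move=> a b; rewrite in_pblock_stack fold_up_conn //; case: a; case: b.
Qed.

Lemma stackp1 P : partition P [set: pt n] -> stack P (id_diagram n) = P.
Proof.
move=> pP; apply: partT_ext => //; first exact: stack_partition.
by move=> a b; rewrite in_pblock_stack fold_dn_conn //; case: a; case: b.
Qed.

Lemma cover_pblock P bP a c : partition P [set: pt n] -> bP \subset P ->
  c \in cover bP -> c \in pblock P a -> a \in cover bP.
Proof.
move=> pP sP /bigcupP[A Ab cA] ca; apply/bigcupP; exists A => //.
have [aa aP] := partT_in a pP.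
by rewrite -(partT_eq pP (subsetP sP _ Ab) cA) (partT_eq pP aP ca).
Qed.

Lemma stack_blobs1p P bP : partition P [set: pt n] -> bP \subset P ->
  stack_blobs (id_diagram n) P set0 bP = bP.
Proof.
move=> pP sP; apply: (@blobs_ext _ P) => //.
  by rewrite -{2}(stack1p pP); exact: stack_blobs_sub.
have fo a : fold_up (outer a) = a by case: a.
have fl a : fold_up (lower a) = a by case: a.
move=> a; apply/mem_cover_blobsP/idP => //; try exact: id_partition.
- exact: sub0set.
- case=> [[c]|[c cb]]; first by rewrite /cover big_set0 inE.
  by rewrite fold_up_conn // fo fl; exact: cover_pblock.
- move=> ab; right; exists a => //; rewrite fold_up_conn // fo fl.
  by case: (partT_in a pP).
Qed.

Lemma stack_blobsp1 P bP : partition P [set: pt n] -> bP \subset P ->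
  stack_blobs P (id_diagram n) bP set0 = bP.
Proof.
move=> pP sP; apply: (@blobs_ext _ P) => //.
  by rewrite -{2}(stackp1 pP); exact: stack_blobs_sub.
have fo a : fold_dn (outer a) = a by case: a.
have fl a : fold_dn (upper a) = a by case: a.
move=> a; apply/mem_cover_blobsP/idP => //; try exact: id_partition.
- exact: sub0set.
- case=> [[c cb]|[c]]; last by rewrite /cover big_set0 inE.
  by rewrite fold_dn_conn // fo fl; exact: cover_pblock.
- move=> ab; left; exists a => //; rewrite fold_dn_conn // fo fl.
  by case: (partT_in a pP).
Qed.

End Identity.

(* Two involutions without common fixed point: a chain starting at a point
   fixed by one of them ends at exactly one other fixed point. *)
Section Dihedral.
Variables (T : finType) (f g : T -> T).
Hypotheses (fK : involutive f) (gK : involutive g).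
Hypothesis fg0 : forall x, f x = x -> g x <> x.

Let h x := g (f x).

Lemma h_inj : injective h.
Proof. by move=> x y /(inv_inj gK) /(inv_inj fK). Qed.

Variable x : T.
Hypothesis fx : f x = x.

Let N := order h x.

Lemma h_order : iter N h x = x. Proof. exact: iter_order h_inj x. Qed.

Lemma f_h k : k <= N -> f (iter k h x) = iter (N - k) h x.
Proof.
elim: k => [|k IH] kN; first by rewrite subn0 h_order fx.
apply: h_inj; have -> : h (f (iter k.+1 h x)) = f (iter k h x).
  by rewrite iterS /h fK gK.
by rewrite (IH (ltnW kN)) -iterS -subSn.
Qed.

Lemma iter_h_inj k l : k < N -> l < N -> iter k h x = iter l h x -> k = l.
Proof.
move=> kN lN E; rewrite -(findex_iter kN) -(findex_iter lN).
by rewrite -!/h E.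
Qed.

Lemma N_gt1 : 1 < N.
Proof.
rewrite ltn_neqAle order_gt0 andbT; apply/eqP=> N1.
by have := h_order; rewrite -N1 /= /h fx; exact: fg0.
Qed.

Let y := iter (uphalf N) h x.

Lemma y_fixed : f y = y \/ g y = y.
Proof.
have N1 := N_gt1; have hN : uphalf N <= N by lia.
case: (boolP (odd N)) => oN; [right | left].
  rewrite /y; have E : uphalf N = (uphalf N).-1.+1 by lia.
  rewrite E iterS {2}/h gK f_h; last by lia.
  by rewrite -iterS; congr (iter _ h x); lia.
by rewrite /y f_h //; congr (iter _ h x); lia.
Qed.

Lemma y_neq : y <> x.
Proof.
have N1 := N_gt1; move=> E.
have : uphalf N = 0 by apply: iter_h_inj => //; lia.
lia.
Qed.

Lemma y_orbit k : f (iter k h x) = iter k h x \/ g (iter k h x) = iter k h x ->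
  k < N -> iter k h x = x \/ iter k h x = y.
Proof.
have N1 := N_gt1; case: k => [|k] H kN; [by left | right].
rewrite /y; congr (iter _ h x); case: H => H.
  have : N - k.+1 = k.+1.
    by apply: iter_h_inj => //; [lia | rewrite -f_h ?H //; lia].
  lia.
have E : f (iter k h x) = iter k.+1 h x by rewrite -H iterS /h gK.
have : f (iter k.+1 h x) = iter k h x by rewrite -E fK.
rewrite f_h; last exact: ltnW.
move/iter_h_inj; lia.
Qed.

Variable e : rel T.
Hypothesis e_fg : forall u v, e u v -> v = u \/ v = f u \/ v = g u.
Hypothesis fg_e : forall u, connect e u (f u) /\ connect e u (g u).

Lemma orbit_e u : connect e x u -> exists2 k, k < N & u = iter k h x.
Proof.
case/connectP=> p; elim/last_ind: p u => [|p z IH] u /=.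
  by move=> _ ->; exists 0; rewrite // order_gt0.
rewrite rcons_path last_rcons => /andP[pp ez] ->.
have [k kN E] := IH _ pp erefl; rewrite E in ez.
have red m : m <= N -> exists2 k, k < N & iter m h x = iter k h x.
  rewrite leq_eqVlt => /orP[/eqP->|mN]; last by exists m.
  by exists 0; rewrite ?h_order // order_gt0.
case: (e_fg ez) => [->|[->|->]].
- by exists k.
- by rewrite f_h ?(ltnW kN) //; apply: red; lia.
- case: k kN {E ez} => [|k] kN.
    rewrite /= -{1}fx -/(h x) -[h x]/(iter 1 h x); exact: red (ltnW N_gt1).
  by rewrite iterS /h gK -/h f_h; [apply: red; lia | lia].
Qed.

Lemma two_fixed : exists2 z, z <> x /\ connect e x z &
  (f z = z \/ g z = z) /\
  forall u, connect e x u -> f u = u \/ g u = u -> u = x \/ u = z.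
Proof.
exists y.
  split; first exact: y_neq.
  rewrite /y; elim: (uphalf N) => [|k IH]; first exact: connect0.
  rewrite iterS /h; apply: connect_trans IH _.
  by apply: connect_trans (fg_e _).1 (fg_e _).2.
split; first exact: y_fixed.
by move=> u /orbit_e[k kN ->] H; exact: y_orbit.
Qed.

End Dihedral.

Section Closure.
Variable n : nat.
Implicit Types (P Q D bP bQ : {set {set pt n}}) (A B : {set pt n}) (a b : pt n).

Definition mate D a : pt n := odflt a [pick b in pblock D a :\ a].

Section Mate.
Variable D : {set {set pt n}}.
Hypothesis tD : TL_diagram D.

Lemma TLp : partition D [set: pt n]. Proof. by case/and3P: tD. Qed.

Lemma TL2 A : A \in D -> #|A| = 2.
Proof. by case/and3P: tD => _ /forall_inP H _ AD; apply/eqP; exact: H. Qed.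

Lemma pblock_mate a : mate D a <> a /\ pblock D a = [set a; mate D a].
Proof.
have [aa aD] := partT_in a TLp.
have c1 : #|pblock D a :\ a| = 1 by have := TL2 aD; rewrite (cardsD1 a) aa add1n => -[].
have /cards1P[b Eb] : #|pblock D a :\ a| == 1 by rewrite c1.
have bb : b \in pblock D a :\ a by rewrite Eb set11.
have -> : mate D a = b.
  rewrite /mate; case: pickP => [c|/(_ b)]; last by rewrite bb.
  by rewrite Eb inE => /eqP.
split; first by move: bb; rewrite !inE => /andP[/eqP].
by rewrite -Eb setD1K.
Qed.

Lemma mate_neq a : mate D a <> a. Proof. by case: (pblock_mate a). Qed.

Lemma in_pblock_mate a b : (b \in pblock D a) = (b == a) || (b == mate D a).
Proof. by case: (pblock_mate a) => _ ->; rewrite !inE. Qed.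

Lemma mate_block A a : A \in D -> a \in A -> mate D a \in A.
Proof.
by move=> AD aA; rewrite -(partT_eq TLp AD aA) in_pblock_mate eqxx orbT.
Qed.

Lemma mateK : involutive (mate D).
Proof.
move=> a; have [aa aD] := partT_in a TLp.
have ma : mate D a \in pblock D a by exact: mate_block.
have : a \in pblock D (mate D a) by rewrite (partT_eq TLp aD ma).
rewrite in_pblock_mate => /orP[/eqP/esym/mate_neq //|/eqP/esym //].
Qed.

Lemma even_closed (S : {set pt n}) : (forall a, a \in S -> mate D a \in S) -> ~~ odd #|S|.
Proof.
move=> cS; pose P := [set A in D | A \subset S].
have pS : partition P S.
  apply/and3P; split.
  - apply/eqP/setP=> a; apply/bigcupP/idP => [[A]|aS].
      by rewrite inE => /andP[_ /subsetP H] /H.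
    have [aa aD] := partT_in a TLp; exists (pblock D a) => //.
    rewrite inE aD; apply/subsetP=> b.
    by rewrite in_pblock_mate => /orP[] /eqP-> //; exact: cS.
  - apply/trivIsetP=> A B; rewrite !inE => /andP[AD _] /andP[BD _].
    by have /trivIsetP := partition_trivIset TLp; apply.
  - rewrite inE negb_and; apply/orP; left; by case/and3P: TLp.
rewrite (card_uniform_partition (n := 2) _ pS) ?oddM ?andbF //.
by move=> A; rewrite inE => /andP[/TL2].
Qed.

Lemma TLnc a b : pos a < pos b -> pos b < pos (mate D a) -> pos (mate D a) < pos (mate D b) -> False.
Proof.
move=> ab bc cd; case/and3P: tD => _ _ /forall_inP nc.
have [aa aD] := partT_in a TLp; have [bb bD] := partT_in b TLp.
have ma := mate_block aD aa; have mb := mate_block bD bb.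
have /forall_inP/(_ _ bD)/forall_inP/(_ _ aa)/forall_inP/(_ _ ma) := nc _ aD.
move=> /forall_inP/(_ _ bb)/forall_inP/(_ _ mb); rewrite ab bc cd /= => /eqP E.
have : b \in pblock D a by rewrite E.
by rewrite in_pblock_mate => /orP[] /eqP Eb; [move: ab | move: bc]; rewrite Eb ltnn.
Qed.

End Mate.

Lemma pos_inj : injective (@pos n).
Proof.
move=> [i|i] [j|j] /= E; try (congr (_ _); apply: val_inj => /=);
  have := ltn_ord i; have := ltn_ord j; lia.
Qed.

Definition cnt (S : {set pt n}) a := #|[set s in S | pos s < pos a]|.

Lemma cnt_mate D (S : {set pt n}) a : TL_diagram D -> (forall s, s \in S -> mate D s \in S) ->
  a \notin S -> odd (cnt S (mate D a)) = odd (cnt S a).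
Proof.
move=> tD cS.
wlog am : a / pos a < pos (mate D a).
  move=> W aS; case: (ltngtP (pos a) (pos (mate D a))) => [lt|gt|/pos_inj/esym/(mate_neq tD) //].
    exact: W.
  have mS : mate D a \notin S by apply: contra aS => /cS; rewrite mateK.
  by have := W (mate D a); rewrite mateK // => ->.
move=> aS; pose M := [set s in S | (pos a < pos s) && (pos s < pos (mate D a))].
have E : cnt S (mate D a) = cnt S a + #|M|.
  rewrite /cnt -cardsUI.
  have -> : [set s in S | pos s < pos a] :&: M = set0.
    apply/setP=> s; rewrite !inE; case: (s \in S) => //=; lia.
  rewrite cards0 addn0; congr #|pred_of_set _|; apply/setP=> s; rewrite !inE.
  case sS: (s \in S) => //=.
  have : pos s != pos a.
    by apply: contraNneq aS => /pos_inj <-.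
  lia.
rewrite E oddD; suff /negbTE-> : ~~ odd #|M| by rewrite addbF.
apply: (even_closed tD) => s; rewrite !inE => /and3P[sS as_ sm]; rewrite cS //=.
have msS := cS _ sS.
apply/andP; split; rewrite ltnNge; apply/negP.
  rewrite leq_eqVlt => /orP[/eqP/pos_inj E1|lt]; first by rewrite -E1 msS in aS.
  apply: (@TLnc D tD (mate D s) a); rewrite ?mateK //.
rewrite leq_eqVlt => /orP[/eqP/pos_inj E1|lt].
  by move: aS; rewrite -(mateK tD a) E1 mateK // sS.
exact: (@TLnc D tD a s).
Qed.

Lemma cnt_exposed D (S : {set pt n}) A a : TL_diagram D -> (forall s, s \in S -> mate D s \in S) ->
  a \notin S -> exposed D A -> a \in A -> odd (cnt S a) = false.
Proof.
move=> tD cS aS eA aA; apply: negbTE; apply: (even_closed tD) => s.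
rewrite !inE => /andP[sS sa]; rewrite cS //=.
rewrite ltnNge leq_eqVlt; apply/negP=> /orP[/eqP/pos_inj E|lt].
  by move: aS; rewrite E cS.
have [ss sD] := partT_in s (TLp tD).
have /forall_inP/(_ _ sD)/forall_inP/(_ _ ss) := eA.
by move=> /forall_inP/(_ _ (mate_block tD sD ss))/forall_inP/(_ _ aA); rewrite sa lt.
Qed.

Section Product.
Variables P Q : {set {set pt n}}.
Hypotheses (tP : TL_diagram P) (tQ : TL_diagram Q).
Let pP := TLp tP.
Let pQ := TLp tQ.
Let e := stack_edge P Q.

Definition fP (x : stk n) : stk n :=
  match x with inl a => upper (mate P a) | inr i => inr i end.
Definition gQ (x : stk n) : stk n :=
  match x with inl (inl i) => inl (inl i) | inl (inr i) => lower (mate Q (inl i))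
  | inr i => lower (mate Q (inr i)) end.

Lemma gQ_lower a : gQ (lower a) = lower (mate Q a). Proof. by case: a. Qed.

Lemma lower_inj : injective (@lower n).
Proof. by move=> [x|x] [y|y] //= []->. Qed.
Lemma outer_inj : injective (@outer n).
Proof. by move=> [x|x] [y|y] //= []->. Qed.

Lemma fPK : involutive fP. Proof. by case=> [a|i] //=; rewrite mateK. Qed.

Lemma stkP (x : stk n) : (exists i, x = inl (inl i)) \/ (exists a, x = lower a).
Proof.
case: x => [[i|i]|i]; first by left; exists i.
  by right; exists (inl i).
by right; exists (inr i).
Qed.

Lemma gQK : involutive gQ.
Proof. by move=> x; case: (stkP x) => [[i ->]|[a ->]] //; rewrite !gQ_lower mateK. Qed.

Lemma fP_fix x : fP x = x <-> exists i, x = inr i.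
Proof.
split=> [|[i ->] //]; case: x => [a|i]; last by exists i.
by move=> [] /(mate_neq tP).
Qed.

Lemma gQ_fix x : gQ x = x <-> exists i, x = inl (inl i).
Proof.
split=> [|[i ->] //]; case: (stkP x) => [[i ->]|[a ->]]; first by exists i.
by rewrite gQ_lower => /lower_inj /(mate_neq tQ).
Qed.

Lemma fix_outer x : fP x = x \/ gQ x = x <-> exists a, x = outer a.
Proof.
split=> [[/fP_fix[i ->]|/gQ_fix[i ->]]|[[i|i] ->]].
- by exists (inr i).
- by exists (inl i).
- by right.
- by left.
Qed.

Lemma e_fg u v : e u v -> v = u \/ v = fP u \/ v = gQ u.
Proof.
case/(stack_edgeP _ _ pP pQ)=> [[a [b [-> -> ]]]|[a [b [-> -> ]]]];
  rewrite (in_pblock_mate tP, in_pblock_mate tQ) => /orP[] /eqP->; auto.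
by rewrite gQ_lower; auto.
Qed.

Lemma fg_e u : connect e u (fP u) /\ connect e u (gQ u).
Proof.
split.
  case: u => [a|i] /=; last exact: connect0.
  by apply: stack_edge_upper => //; rewrite in_pblock_mate // eqxx orbT.
case: (stkP u) => [[i ->]|[a ->]]; first exact: connect0.
rewrite gQ_lower; apply: stack_edge_lower => //.
by rewrite in_pblock_mate // eqxx orbT.
Qed.

Lemma chain_end a : exists2 b, b <> a /\ connect e (outer a) (outer b) &
  forall c, connect e (outer a) (outer c) -> c = a \/ c = b.
Proof.
have fin : (exists2 z, z <> outer a /\ connect e (outer a) z &
    (fP z = z \/ gQ z = z) /\
    forall u, connect e (outer a) u -> fP u = u \/ gQ u = u -> u = outer a \/ u = z) ->
  exists2 b, b <> a /\ connect e (outer a) (outer b) &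
    forall c, connect e (outer a) (outer c) -> c = a \/ c = b.
  move=> [z [za az] [/fix_outer[b Eb] H]]; subst z; exists b.
    by split=> // ba; apply: za; rewrite ba.
  move=> c /H; case; first by apply/fix_outer; exists c.
    by move/outer_inj; left.
  by move/outer_inj; right.
apply: fin; case: a => i.
  have H0 x : gQ x = x -> fP x <> x by move=> /gQ_fix[k ->] /fP_fix[l].
  have He u v : e u v -> v = u \/ v = gQ u \/ v = fP u by move/e_fg; tauto.
  have Hf u : connect e u (gQ u) /\ connect e u (fP u) by case: (fg_e u).
  have Hx : gQ (outer (inl i)) = outer (inl i) by [].
  have [z H1 [H2 H3]] := two_fixed gQK fPK H0 Hx He Hf.
  exists z => //; split; first by tauto.
  by move=> u cu fu; apply: H3 => //; tauto.
have H0 x : fP x = x -> gQ x <> x by move=> /fP_fix[k ->] /gQ_fix[l].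
have Hx : fP (outer (inr i)) = outer (inr i) by [].
have [z H1 [H2 H3]] := two_fixed fPK gQK H0 Hx e_fg fg_e.
by exists z.
Qed.

Lemma stack_card2 A : A \in stack P Q -> #|A| = 2.
Proof.
move=> AS; have /set0Pn[a aA] : A != set0.
  by apply: contraTneq AS => ->; case/and3P: (stack_partition P Q).
have [b [ba ab] H] := chain_end a.
have -> : A = [set a; b].
  rewrite (stackP AS aA); apply/setP=> c; rewrite !inE.
  by apply/idP/idP=> [/H[]->|/orP[]/eqP->]; rewrite ?eqxx ?orbT ?connect0.
by rewrite cards2; case: eqP => // Ea; case: ba.
Qed.

(* Crossing parity with a union [X] of components. *)
Section Colour.
Variable X : {set stk n}.
Hypothesis cX : forall x y, connect e x y -> (x \in X) = (y \in X).

Let SU := @upper n @^-1: X.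
Let SL := @lower n @^-1: X.
Let SO := @outer n @^-1: X.

Lemma SU_closed a : a \in SU -> mate P a \in SU.
Proof.
by rewrite !inE => aX; rewrite -(cX (x := upper a)) //; case: (fg_e (upper a)).
Qed.
Lemma SL_closed a : a \in SL -> mate Q a \in SL.
Proof.
rewrite !inE => aX; rewrite -(cX (x := lower a)) //; case: (fg_e (lower a)) => _.
by rewrite gQ_lower.
Qed.

Lemma cardE (p : pred (pt n)) : #|[set s | p s]| = \sum_i p (inl i) + \sum_i p (inr i).
Proof.
rewrite -sum1_card big_mkcond /= big_sumType /=.
by congr (_ + _); apply: eq_bigr => i _; rewrite inE; case: (p _).
Qed.

Let t := \sum_(i < n) (inl (inl i) \in X : nat).
Let m := \sum_(i < n) (inl (inr i) \in X : nat).

Lemma tm_even : odd t = odd m.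
Proof.
have := even_closed tP SU_closed.
have -> : SU = [set s | upper s \in X] by apply/setP=> s; rewrite !inE.
by rewrite cardE -/t -/m oddD; case: odd; case: odd.
Qed.

Lemma cntE (S : {set pt n}) a : cnt S a =
  match a with
  | inl i => \sum_(j < n) ((inl j \in S) && (j < i) : nat)
  | inr i => \sum_(j < n) (inl j \in S : nat)
             + \sum_(j < n) ((inr j \in S) && (i < j) : nat)
  end.
Proof.
rewrite /cnt cardE; case: a => i /=.
  rewrite [X in _ + X]big1 ?addn0 // => j _.
  by have := ltn_ord i; case: (_ \in S) => //=; lia.
congr (_ + _); apply: eq_bigr => j _.
  by have := ltn_ord j; case: (_ \in S) => //=; lia.
by have := ltn_ord j; have := ltn_ord i; case: (_ \in S) => //=; lia.
Qed.

Definition colour (x : stk n) : bool :=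
  match x with
  | inl (inl i) => odd (cnt SO (inl i))
  | inl (inr i) => odd (cnt SL (inl i))
  | inr i => odd (cnt SO (inr i))
  end.

Lemma colour_outer a : colour (outer a) = odd (cnt SO a).
Proof. by case: a. Qed.

Lemma colour_upper a : upper a \notin X -> colour (upper a) = odd (cnt SU a).
Proof.
case: a => i aX /=; rewrite !cntE.
  by congr odd; apply: eq_bigr => j _; rewrite !inE.
have -> : \sum_(j < n) (inl j \in SU : nat) = t.
  by apply: eq_bigr => j _; rewrite !inE.
rewrite oddD tm_even -oddD.
have -> : m = \sum_(j < n) ((inl j \in SL) && (j < i) : nat)
              + \sum_(j < n) ((inr j \in SU) && (i < j) : nat).
  rewrite -big_split /=; apply: eq_bigr => j _; rewrite !inE /=.
  case: (ltngtP j i) => [||/val_inj E]; rewrite ?andbT ?andbF ?addn0 //.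
  by rewrite E; move: aX; rewrite /upper => /negbTE->.
by rewrite !oddD -addbA addbb addbF.
Qed.

Lemma colour_lower a : colour (lower a) = odd (cnt SL a).
Proof.
case: a => i //=; rewrite !cntE.
have -> : \sum_(j < n) (inl j \in SO : nat) = t.
  by apply: eq_bigr => j _; rewrite !inE.
have -> : \sum_(j < n) (inl j \in SL : nat) = m.
  by apply: eq_bigr => j _; rewrite !inE.
rewrite !oddD tm_even; congr (_ (+) odd _).
by apply: eq_bigr => j _; rewrite !inE.
Qed.

Lemma colour_conn x y : x \notin X -> connect e x y -> colour x = colour y.
Proof.
move=> xX /connectP[p]; elim: p x xX => [|z p IH] x xX /=; first by move=> _ ->.
case/andP=> xz pp Ey; have zX : z \notin X by rewrite -(cX (connect1 xz)).
rewrite -(IH z) // => {IH pp Ey p}.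
case/(stack_edgeP _ _ pP pQ): xz xX zX => [[a [b [-> -> ]]]|[a [b [-> -> ]]]];
  rewrite (in_pblock_mate tP, in_pblock_mate tQ) => /orP[] /eqP-> // aX bX.
  rewrite !colour_upper // (cnt_mate tP) //; first exact: SU_closed.
  by rewrite inE.
rewrite !colour_lower // (cnt_mate tQ) //; first exact: SL_closed.
by rewrite inE.
Qed.

Lemma colour_upper_exposed A a : upper a \notin X -> exposed P A -> a \in A ->
  colour (upper a) = false.
Proof.
move=> aX eA aA; rewrite colour_upper //.
by apply: (cnt_exposed tP _ _ eA aA); [exact: SU_closed | rewrite inE].
Qed.

Lemma colour_lower_exposed A a : lower a \notin X -> exposed Q A -> a \in A ->
  colour (lower a) = false.
Proof.
move=> aX eA aA; rewrite colour_lower //.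
by apply: (cnt_exposed tQ _ _ eA aA); [exact: SL_closed | rewrite inE].
Qed.

End Colour.

Lemma comp_closed z x y : connect e x y -> (x \in component P Q z) = (y \in component P Q z).
Proof.
move=> xy; rewrite !inE; apply/idP/idP => H; first exact: connect_trans H xy.
by apply: connect_trans H _; rewrite /e stack_edge_sym.
Qed.

Lemma block2 (A : {set pt n}) b d : #|A| = 2 -> b \in A -> d \in A -> b != d -> A = [set b; d].
Proof.
move=> A2 bA dA bd; apply/esym/eqP; rewrite eqEcard cards2 bd A2 andbT.
by apply/subsetP=> c; rewrite !inE => /orP[]/eqP->.
Qed.

Lemma pos_neq a b : pos a < pos b -> a != b.
Proof. by apply: contraTneq => ->; rewrite ltnn. Qed.

Lemma stack_noncrossing : noncrossing (stack P Q).
Proof.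
apply/forall_inP=> A AS; apply/forall_inP=> B BS.
apply/forall_inP=> a aA; apply/forall_inP=> c cA.
apply/forall_inP=> b bB; apply/forall_inP=> d dB.
apply/implyP=> /and3P[ab bc cd]; apply: contraT => AB.
have EA := stackP AS aA; have EB := stackP BS bB.
have A2 := block2 (stack_card2 AS) aA cA (pos_neq (ltn_trans ab bc)).
pose X := component P Q (outer a).
have SOE : @outer n @^-1: X = [set a; c] by rewrite -EA.
have bX : outer b \notin X.
  apply: contra AB => bX; have bA : b \in A by rewrite EA inE.
  by rewrite -(partT_eq (stack_partition P Q) AS bA)
             -(partT_eq (stack_partition P Q) BS bB).
have bd : connect e (outer b) (outer d) by move: dB; rewrite EB !inE.
have := colour_conn (@comp_closed (outer a)) bX bd.
rewrite !colour_outer -/X SOE /cnt.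
have -> : [set s in [set a; c] | pos s < pos b] = [set a].
  apply/setP=> s; rewrite !inE; case: (eqVneq s a) => [->|_] /=; first by rewrite ab.
  by case: (eqVneq s c) => [->|//]; rewrite /= ltnNge ltnW.
have -> : [set s in [set a; c] | pos s < pos d] = [set a; c].
  apply/setP=> s; rewrite !inE; case: (eqVneq s a) => [->|_] /=.
    by rewrite (ltn_trans ab (ltn_trans bc cd)).
  by case: (eqVneq s c) => [->|//].
by rewrite cards1 cards2 (pos_neq (ltn_trans ab bc)).
Qed.

Lemma stack_TL : TL_diagram (stack P Q).
Proof.
apply/and3P; split; [exact: stack_partition | | exact: stack_noncrossing].
by apply/forall_inP=> A /stack_card2 ->.
Qed.

Lemma stack_exposed bP bQ A :
  bP \subset P -> bQ \subset Q -> [forall B in bP, exposed P B] ->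
  [forall B in bQ, exposed Q B] ->
  A \in stack_blobs P Q bP bQ -> exposed (stack P Q) A.
Proof.
move=> sP sQ /forall_inP eP /forall_inP eQ Ab.
have AS := subsetP (stack_blobs_sub P Q bP bQ) _ Ab.
apply/forall_inP=> B BS; apply/forall_inP=> b bB; apply/forall_inP=> d dB.
apply/forall_inP=> a aA; apply/negP=> /andP[ba ad].
have bd := pos_neq (ltn_trans ba ad).
have EB := stackP BS bB; have B2 := block2 (stack_card2 BS) bB dB bd.
pose X := component P Q (outer b).
have SOE : @outer n @^-1: X = [set b; d] by rewrite -EB.
have aX : outer a \notin X.
  apply/negP=> aX; have : a \in B by rewrite EB inE.
  by rewrite B2 !inE (eq_sym a b) (negbTE (pos_neq ba)) (negbTE (pos_neq ad)).
have ca : colour X (outer a) = true.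
  rewrite colour_outer SOE /cnt.
  have -> : [set s in [set b; d] | pos s < pos a] = [set b].
    apply/setP=> s; rewrite !inE; case: (eqVneq s b) => [->|_] /=; first by rewrite ba.
    by case: (eqVneq s d) => [->|//]; rewrite /= ltnNge ltnW.
  by rewrite cards1.
have cX := @comp_closed (outer b).
case/(mem_stack_blobsP AS aA pP pQ sP sQ): Ab => [[c /bigcupP[C Cb cC] ac]|[c /bigcupP[C Cb cC] ac]].
  have uX : upper c \notin X by rewrite -(cX _ _ ac).
  have := colour_upper_exposed cX uX (eP _ Cb) cC.
  by rewrite -(colour_conn cX aX ac) ca.
have uX : lower c \notin X by rewrite -(cX _ _ ac).
have := colour_lower_exposed cX uX (eQ _ Cb) cC.
by rewrite -(colour_conn cX aX ac) ca.
Qed.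

End Product.
End Closure.

Section Generators.
Variable n : nat.
Implicit Types (A B : {set pt n}) (a b c d : pt n) (i k : 'I_n).

Lemma id_span A a c : A \in id_diagram n -> a \in A -> c \in A -> pos a < pos c ->
  exists k, pos a = k /\ pos c = n + n - k.+1.
Proof.
case/imsetP=> k _ ->; rewrite !inE => /orP[]/eqP-> /orP[]/eqP-> /=;
  have := ltn_ord k; try lia.
by move=> kn lt; exists k; split; lia.
Qed.

Lemma hook_span i A a c : A \in hook i -> a \in A -> c \in A -> pos a < pos c ->
  [\/ pos a = i.-1 /\ pos c = i, pos a = n + n - i.+1 /\ pos c = n + n - i |
      exists k, [/\ pos a = k, pos c = n + n - k.+1, k != i.-1 :> nat & k != i :> nat]].
Proof.
rewrite inE => /orP[].
  rewrite !inE => /orP[]/eqP->; rewrite !inE => /orP[]/eqP-> /orP[]/eqP-> /=;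
    have := ltn_ord i; try lia; move=> ? ?.
    by constructor 1.
  by constructor 2; lia.
case/imsetP=> k; rewrite inE => /andP[k1 k2] ->.
rewrite !inE => /orP[]/eqP-> /orP[]/eqP-> /=; have := ltn_ord k; try lia.
by move=> kn lt; constructor 3; exists k; split=> //; lia.
Qed.

Lemma id_TL : TL_diagram (id_diagram n).
Proof.
apply/and3P; split; first exact: id_partition.
  by apply/forall_inP=> _ /imsetP[k _ ->]; rewrite cards2 -sum_eqE.
apply/forall_inP=> A AS; apply/forall_inP=> B BS.
apply/forall_inP=> a aA; apply/forall_inP=> c cA.
apply/forall_inP=> b bB; apply/forall_inP=> d dB.
apply/implyP=> /and3P[ab bc cd].
have [k [E1 E2]] := id_span AS aA cA (ltn_trans ab bc).
have [l [E3 E4]] := id_span BS bB dB (ltn_trans bc cd).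
lia.
Qed.

Lemma hook_partition i : i != 0 :> nat -> partition (hook i) [set: pt n].
Proof.
move=> i0; have pi : prev i != i by rewrite -val_eqE /=; lia.
have HE a A : A \in hook i -> a \in A ->
  A = match a with
      | inl k => if (k == prev i) || (k == i) then [set inl (prev i); inl i]
                 else [set inl k; inr k]
      | inr k => if (k == prev i) || (k == i) then [set inr (prev i); inr i]
                 else [set inl k; inr k]
      end.
  rewrite inE => /orP[].
    by rewrite !inE => /orP[]/eqP->; rewrite !inE => /orP[]/eqP->; rewrite eqxx ?orbT.
  case/imsetP=> k; rewrite inE => /andP[/negbTE k1 /negbTE k2] ->.
  by rewrite !inE => /orP[]/eqP->; rewrite k1 k2.
apply: partitionT_intro.
- rewrite inE negb_or; apply/andP; split.
    rewrite !inE negb_or; apply/andP; split; rewrite eq_sym; apply/set0Pn.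
      by exists (inl i); rewrite !inE eqxx orbT.
    by exists (inr i); rewrite !inE eqxx orbT.
  apply/imsetP=> -[k _ /esym/eqP]; apply/negP/set0Pn.
  by exists (inl k); rewrite !inE eqxx.
- move=> a; case: (boolP ((idx a == prev i) || (idx a == i))) => H.
    case: a H => k /= H.
      exists [set inl (prev i); inl i]; first by rewrite !inE eqxx.
      by rewrite !inE; case/orP: H => /eqP->; rewrite eqxx ?orbT.
    exists [set inr (prev i); inr i]; first by rewrite !inE eqxx orbT.
    by rewrite !inE; case/orP: H => /eqP->; rewrite eqxx ?orbT.
  exists [set inl (idx a); inr (idx a)]; last by rewrite id_blockP.
  rewrite inE; apply/orP; right; apply: imset_f.
  by rewrite inE -negb_or.
- by move=> A B a AH BH aA aB; rewrite (HE a A) // (HE a B).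
Qed.

Lemma hook_TL i : i != 0 :> nat -> TL_diagram (hook i).
Proof.
move=> i0; have pi : prev i != i by rewrite -val_eqE /=; lia.
apply/and3P; split; first exact: hook_partition.
  apply/forall_inP=> A; rewrite inE => /orP[].
    by rewrite !inE => /orP[]/eqP->; rewrite cards2 -sum_eqE /= pi.
  by case/imsetP=> k _ ->; rewrite cards2 -sum_eqE.
apply/forall_inP=> A AS; apply/forall_inP=> B BS.
apply/forall_inP=> a aA; apply/forall_inP=> c cA.
apply/forall_inP=> b bB; apply/forall_inP=> d dB.
apply/implyP=> /and3P[ab bc cd]; have := ltn_ord i.
have := hook_span AS aA cA (ltn_trans ab bc).
have := hook_span BS bB dB (ltn_trans bc cd).
move: (pos a) (pos b) (pos c) (pos d) (nat_of_ord i) ab bc cd i0.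
clear=> pa pb pc pd j ab bc cd i0 H1 H2 jn.
have jj : j.-1 < n by lia.
case: H1 => [[E1 E2]|[E1 E2]|[[k kn] /= [E1 E2 k1 k2]]];
case: H2 => [[E3 E4]|[E3 E4]|[[l ln] /= [E3 E4 l1 l2]]]; lia.
Qed.

Lemma cut_partition i : partition (cut i) [set: pt n].
Proof.
have HE a A : A \in cut i -> a \in A ->
  A = if idx a == i then [set a] else [set inl (idx a); inr (idx a)].
  rewrite inE => /orP[].
    by rewrite !inE => /orP[]/eqP->; rewrite !inE => /eqP->; rewrite eqxx.
  case/imsetP=> k; rewrite inE => /negbTE k1 ->.
  by rewrite !inE => /orP[]/eqP->; rewrite /= k1.
apply: partitionT_intro.
- rewrite inE negb_or; apply/andP; split.
    rewrite !inE negb_or; apply/andP; split; rewrite eq_sym; apply/set0Pn.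
      by exists (inl i); rewrite !inE eqxx.
    by exists (inr i); rewrite !inE eqxx.
  apply/imsetP=> -[k _ /esym/eqP]; apply/negP/set0Pn.
  by exists (inl k); rewrite !inE eqxx.
- move=> a; case: (boolP (idx a == i)) => H.
    exists [set a]; last by rewrite inE.
    by case: a H => k /= /eqP->; rewrite !inE eqxx ?orbT.
  exists [set inl (idx a); inr (idx a)]; last by rewrite id_blockP.
  by rewrite inE; apply/orP; right; apply: imset_f; rewrite inE.
- by move=> A B a AH BH aA aB; rewrite (HE a A) // (HE a B).
Qed.

Lemma motzkin_gen_partition i : partition (motzkin_gen_blocks i) [set: pt n].
Proof.
rewrite /motzkin_gen_blocks; case: eqP => [_|/eqP i0]; first exact: cut_partition.
exact: hook_partition.
Qed.

Lemma blob_gen_blobbed i : blobbed_TL (blob_gen_diagram i).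
Proof.
rewrite /blob_gen_diagram; case: eqP => [i0|/eqP i0]; apply/and3P; split => /=.
- exact: id_TL.
- by rewrite sub1set; apply: imset_f.
- apply/forall_inP=> A; rewrite inE => /eqP->.
  apply/forall_inP=> B BS; apply/forall_inP=> b bB; apply/forall_inP=> d dB.
  apply/forall_inP=> a aA; apply/negP=> /andP[ba ad].
  have [k [E3 E4]] := id_span BS bB dB (ltn_trans ba ad).
  move: aA ba ad; rewrite !inE => /orP[]/eqP-> /=; have := ltn_ord i; lia.
- exact: hook_TL.
- exact: sub0set.
- by apply/forall_inP=> A; rewrite inE.
Qed.

End Generators.

Section Monoids.
Variable n : nat.

Lemma blocksP (x : partition_monoid n) : partition x [set: pt n].
Proof. by case: x. Qed.

Definition part_one : partition_monoid n := PartitionMonoid (id_partition n).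

Definition part_mul (x y : partition_monoid n) : partition_monoid n :=
  PartitionMonoid (stack_partition x y).

Lemma part_mulA : associative part_mul.
Proof. by move=> x y z; apply: val_inj; apply: stackA; apply: blocksP. Qed.
Lemma part_mul1 : left_id part_one part_mul.
Proof. by move=> x; apply: val_inj; apply: stack1p; apply: blocksP. Qed.
Lemma part_mulr1 : right_id part_one part_mul.
Proof. by move=> x; apply: val_inj; apply: stackp1; apply: blocksP. Qed.

HB.instance Definition _ := isMonoid.Build (partition_monoid n)
  part_mulA part_mul1 part_mulr1.

Lemma arcs_blobsP (x : blob_monoid n) : blobbed_TL x.
Proof. by case: x. Qed.

Lemma blob_one_subproof : blobbed_TL (id_diagram n, set0).
Proof.
apply/and3P; split=> /=; [exact: id_TL | exact: sub0set |].
by apply/forall_inP=> A; rewrite inE.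
Qed.

Definition blob_one : blob_monoid n := BlobMonoid blob_one_subproof.

Lemma blob_mul_subproof (x y : blob_monoid n) :
  blobbed_TL (stack x.1 y.1, stack_blobs x.1 y.1 x.2 y.2).
Proof.
have /and3P[tx sx ex] := arcs_blobsP x; have /and3P[ty sy ey] := arcs_blobsP y.
apply/and3P; split=> /=; [exact: stack_TL | exact: stack_blobs_sub |].
apply/forall_inP=> A; exact: stack_exposed.
Qed.

Definition blob_mul (x y : blob_monoid n) : blob_monoid n :=
  BlobMonoid (blob_mul_subproof x y).

Lemma blob_mulA : associative blob_mul.
Proof.
move=> x y z; apply: val_inj => /=.
have /and3P[/TLp px sx _] := arcs_blobsP x; have /and3P[/TLp py sy _] := arcs_blobsP y.
have /and3P[/TLp pz sz _] := arcs_blobsP z.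
by rewrite stackA // stack_blobsA.
Qed.
Lemma blob_mul1 : left_id blob_one blob_mul.
Proof.
move=> x; apply: val_inj => /=; have /and3P[/TLp px sx _] := arcs_blobsP x.
by rewrite stack1p // stack_blobs1p // -surjective_pairing.
Qed.
Lemma blob_mulr1 : right_id blob_one blob_mul.
Proof.
move=> x; apply: val_inj => /=; have /and3P[/TLp px sx _] := arcs_blobsP x.
by rewrite stackp1 // stack_blobsp1 // -surjective_pairing.
Qed.

HB.instance Definition _ := isMonoid.Build (blob_monoid n)
  blob_mulA blob_mul1 blob_mulr1.

Definition blob_gen (i : 'I_n) : blob_monoid n := BlobMonoid (blob_gen_blobbed i).

Definition motzkin_gen (i : 'I_n) : partition_monoid n :=
  PartitionMonoid (motzkin_gen_partition i).

Definition submonoid_pred (S : {set partition_monoid n}) : bool :=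
  (1%g \in S) && [forall x in S, forall y in S, (x * y)%g \in S].

Definition motzkin_blob_set : {set partition_monoid n} :=
  \bigcap_(S : {set partition_monoid n}
            | submonoid_pred S && [forall i, motzkin_gen i \in S]) S.

Lemma motzkin_blob_closed :
  monoid_closed [pred x : partition_monoid n | x \in motzkin_blob_set].
Proof.
split=> [|x y]; rewrite ?inE; first by apply/bigcapP=> S /andP[/andP[]].
move=> /bigcapP xS /bigcapP yS; apply/bigcapP=> S HS.
have /andP[/andP[_ /forall_inP H] _] := HS.
by have /forall_inP := H _ (xS _ HS); apply; exact: yS.
Qed.

Record motzkin_blob_monoid := MotzkinBlobMonoid {
  motzkin_val :> partition_monoid n;
  _ : motzkin_val \in motzkin_blob_set
}.

End Monoids.

HB.instance Definition _ n := [isSub for @motzkin_val n].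
HB.instance Definition _ n := [Finite of motzkin_blob_monoid n by <:].
HB.instance Definition _ n := SubChoice_isSubMonoid.Build
  (partition_monoid n) _ (motzkin_blob_monoid n) (@motzkin_blob_closed n).

(* Main.v *)
(* Cutting every blobbed arc into two singletons sends blobbed diagrams to
   partitions. This is multiplicative: the component of a boundary point in the
   stacked graph is a chain, and cutting one of its links separates the two
   ends. It is injective: exposed arcs are neither nested nor crossing, so the
   singletons are paired consecutively along the boundary. The image lies in the
   monoid generated by the U_i because the partitions obtained, read as
   non-crossing involutions whose fixed points are covered by no arc, can be
   peeled. If the top point 1 is fixed, a U_0 factors out and 1 gets joined to
   the next fixed point; if {i, i+1} is a top block, a U_i factors out and {i, i+1} is
   reconnected with the next strand crossing the vertical line between i and
   i+1, where fixed points count as ends of strands coming from the left wall.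
   Either step decreases the total horizontal extent of the strands, and only
   the identity cannot be peeled. *)
Require Import Defs.
From mathcomp Require Import all_boot.
From mathcomp Require Import perm zify.

Set Implicit Arguments.
Unset Strict Implicit.
Unset Printing Implicit Defensive.

(** * Chains after cutting some of their links *)

(* [f'] and [g'] arise from [f] and [g] by turning some matched points into
   fixed points, i.e. by cutting links. If two chain ends stay connected, a
   shortest path between them has no cut at any of its points, so it already
   exhausts the chain. *)
Section ShortestPath.
Variables (T : finType) (f g f' g' : T -> T) (e e' : rel T).
Hypothesis f'f : forall v, f' v = v \/ f' v = f v.
Hypothesis g'g : forall v, g' v = v \/ g' v = g v.
Hypothesis eE : forall u v, e u v -> v = u \/ v = f u \/ v = g u.
Hypothesis e'E : forall u v, e' u v -> v = u \/ v = f' u \/ v = g' u.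
Hypothesis e'_sym : symmetric e'.

(** Once it holds at every vertex of [s], the set [s] is closed under [f] and [g], hence under
    [e]. *)
Definition unsplit_in (s : seq T) v :=
  [/\ f' v = f v, g' v = g v, f v \in s & g v \in s].

(** Each of [f'] and [g'] offers at most one neighbour of [v], so two distinct neighbours use both
    maps, and a map that moves [v] is not cut there. *)
Lemma unsplit_mid s u v w : e' u v -> e' v w -> u != v -> w != v -> u != w ->
  u \in s -> w \in s -> unsplit_in s v.
Proof.
have Ef x : f' v = x -> x <> v -> f v = x by case: (f'f v) => -> // -> [].
have Eg x : g' v = x -> x <> v -> g v = x by case: (g'g v) => -> // -> [].
rewrite e'_sym => /e'E Hu /e'E Hw /eqP uv /eqP wv /eqP uw us ws.
case: Hu => [//|[/esym Eu|/esym Eu]]; case: Hw => [//|[/esym Ew|/esym Ew]].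
- by case: uw; rewrite -Eu.
- by rewrite /unsplit_in (Ef _ Eu uv) (Eg _ Ew wv).
- by rewrite /unsplit_in (Eg _ Eu uv) (Ef _ Ew wv).
- by case: uw; rewrite -Eu.
Qed.

(** At a chain end one map fixes [v] already before cutting, so the neighbour [u] comes from the
    other map, which is therefore not cut at [v]. *)
Lemma unsplit_end s u v : e' u v -> u != v -> f v = v \/ g v = v ->
  u \in s -> v \in s -> unsplit_in s v.
Proof.
have Ef x : f' v = x -> x <> v -> f v = x by case: (f'f v) => -> // -> [].
have Eg x : g' v = x -> x <> v -> g v = x by case: (g'g v) => -> // -> [].
have Ef' : f v = v -> f' v = v by case: (f'f v) => ->.
have Eg' : g v = v -> g' v = v by case: (g'g v) => ->.
rewrite e'_sym => /e'E Hu /eqP uv Hv us vs.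
case: Hu => [//|[/esym Eu|/esym Eu]]; case: Hv => Hv.
- by case: uv; rewrite -Eu Ef'.
- by rewrite /unsplit_in (Ef _ Eu uv) Eg' ?Hv.
- by rewrite /unsplit_in (Eg _ Eu uv) Ef' ?Hv.
- by case: uv; rewrite -Eu Eg'.
Qed.

Lemma unsplit_path u w p : path e' w p -> uniq (u :: w :: p) -> e' u w ->
  f (last w p) = last w p \/ g (last w p) = last w p ->
  forall v, v \in w :: p -> unsplit_in (u :: w :: p) v.
Proof.
elim: p u w => [|z p IH] u w.
  move=> _ /=; rewrite inE andbT => uw euw Hw v; rewrite inE => /eqP->.
  by apply: unsplit_end euw uw Hw _ _; rewrite !inE eqxx ?orbT.
move=> /= /andP[wz pp] /and3P[]; rewrite !inE !negb_or => /and3P[uw uz up] /andP[wz' wp] U euw Hl v.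
case/orP=> [/eqP->|vp].
  by apply: unsplit_mid euw wz uw _ uz _ _; rewrite ?inE ?eqxx ?orbT // eq_sym.
have := IH w z pp _ wz Hl v vp.
case; first by rewrite /= inE negb_or wz' wp.
by move=> ? ? H1 H2; split=> //; rewrite inE (H1, H2) orbT.
Qed.

Lemma unsplit_component x y v : x != y -> connect e' x y ->
  f x = x \/ g x = x -> f y = y \/ g y = y -> connect e x v ->
  f' v = f v /\ g' v = g v.
Proof.
move=> xy /connectP[p0 /shortenP[p pp U _]] Ey Hx Hy xv; subst y.
case: p pp U xy Hy => [|z p] /=; first by rewrite eqxx.
case/andP=> xz pp U xy Hy.
have G w : w \in [:: x, z & p] -> unsplit_in [:: x, z & p] w.
  rewrite inE => /orP[/eqP->|]; last exact: unsplit_path.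
  have xz' : z != x by move: U => /andP[]; rewrite inE negb_or eq_sym => /andP[].
  rewrite e'_sym in xz.
  by apply: unsplit_end xz xz' Hx _ _; rewrite !inE eqxx ?orbT.
suff /G[] : v \in [:: x, z & p] by [].
(* The path is closed under [e], so an [e]-path from [x] to [v] never leaves it. *)
have : x \in [:: x, z & p] by rewrite inE eqxx.
case/connectP: xv => q; move: [:: x, z & p] G => s G.
elim: q x {xy Hx U xz} => [|w q IH] u /=; first by move=> _ ->.
case/andP=> uw wq Ev us; apply: (IH w) => //.
by have [_ _ fu gu] := G _ us; case: (eE uw) => [->|[->|->]].
Qed.

End ShortestPath.

(** * Partitions given by involutions; the cutting map and its injectivity *)

Section Pairing.
Variable n : nat.
Implicit Types (P Q R D : {set {set pt n}}) (A B : {set pt n}) (a b c x y : pt n).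
Implicit Types (s t : pt n -> pt n) (X Y : blob_monoid n).

(** A fixed point of [s] gives a singleton block, so diagrams before and after cutting both have
    this form. *)
Definition pairing s : {set {set pt n}} := [set [set x; s x] | x : pt n].

Section Involution.
Variable s : pt n -> pt n.
Hypothesis sK : involutive s.

Lemma pairing_eq A a : A \in pairing s -> a \in A -> A = [set a; s a].
Proof.
by case/imsetP=> x _ ->; rewrite !inE => /orP[]/eqP-> //; rewrite sK setUC.
Qed.

Lemma pairing_partition : partition (pairing s) [set: pt n].
Proof.
apply: partitionT_intro.
- by apply/negP=> /imsetP[x _ /setP/(_ x)]; rewrite in_set0 set21.
- by move=> x; exists [set x; s x]; [exact: imset_f | exact: set21].
- by move=> A B x As Bs xA xB; rewrite (pairing_eq As xA) (pairing_eq Bs xB).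
Qed.

Lemma in_pblock_pairing a b : (b \in pblock (pairing s) a) = (b == a) || (b == s a).
Proof.
have [aA AP] := partT_in a pairing_partition.
by rewrite (pairing_eq AP aA) !inE.
Qed.

End Involution.

Lemma pairing_eq_partition s P : involutive s -> partition P [set: pt n] ->
  (forall a b, (b \in pblock P a) = (b == a) || (b == s a)) -> pairing s = P.
Proof.
move=> sK pP H; apply: partT_ext => //; first exact: pairing_partition.
by move=> a b; rewrite in_pblock_pairing // H.
Qed.

Lemma pairing_mate D : TL_diagram D -> pairing (mate D) = D.
Proof.
move=> tD; apply: pairing_eq_partition; [exact: mateK | exact: TLp |].
by move=> a b; rewrite in_pblock_mate.
Qed.

(** [F] is an invariant: along an edge of the stacked graph the block of [R] containing the image
    under [F] does not change, so connected outer points share a block of [R]. The last hypothesis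
    is the converse. *)
Lemma stack_eq P Q R (F : stk n -> pt n) :
  partition P [set: pt n] -> partition Q [set: pt n] -> partition R [set: pt n] ->
  (forall a, F (outer a) = a) ->
  (forall a b, b \in pblock P a -> F (upper b) \in pblock R (F (upper a))) ->
  (forall a b, b \in pblock Q a -> F (lower b) \in pblock R (F (lower a))) ->
  (forall a b, b \in pblock R a -> connect (stack_edge P Q) (outer a) (outer b)) ->
  stack P Q = R.
Proof.
move=> pP pQ pR Fo FP FQ RC; apply: partT_ext => //; first exact: stack_partition.
move=> a b; rewrite in_pblock_stack; apply/idP/idP; last exact: RC.
rewrite -{2}(Fo a) -{2}(Fo b) => /connectP[p].
move: (outer a) (outer b) => u v; elim: p u => [|w p IH] u /=.
  by move=> _ ->; case: (partT_in (F u) pR).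
case/andP=> uw wp Ev; apply: pblock_trans (IH w wp Ev) => //.
by case/(stack_edgeP _ _ pP pQ): uw => -[c [d [-> -> cd]]]; [exact: FP | exact: FQ].
Qed.

Definition split_mate (X : {set {set pt n}} * {set {set pt n}}) a : pt n :=
  if a \in cover X.2 then a else mate X.1 a.

Section Split.
Variable X : blob_monoid n.

Lemma blobTL : TL_diagram X.1. Proof. by case/and3P: (arcs_blobsP X). Qed.
Lemma blob_sub : X.2 \subset X.1. Proof. by case/and3P: (arcs_blobsP X). Qed.

Lemma mate_blob a : (mate X.1 a \in cover X.2) = (a \in cover X.2).
Proof.
have H b : b \in cover X.2 -> mate X.1 b \in cover X.2.
  case/bigcupP=> A AX bA; apply/bigcupP; exists A => //.
  apply: (mate_block blobTL _ bA); exact: (subsetP blob_sub).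
by apply/idP/idP=> /H //; rewrite mateK //; exact: blobTL.
Qed.

Lemma blob_exposed a b : b \in cover X.2 -> pos a < pos b -> pos b < pos (mate X.1 a) -> False.
Proof.
case/bigcupP=> A AX bA ab bm; case/and3P: (arcs_blobsP X) => _ _ /forall_inP/(_ _ AX).
have [aa aD] := partT_in a (TLp blobTL).
move=> /forall_inP/(_ _ aD)/forall_inP/(_ _ aa)/forall_inP/(_ _ (mate_block blobTL aD aa)).
by move/forall_inP/(_ _ bA); rewrite ab bm.
Qed.

Lemma split_mateK : involutive (split_mate X).
Proof.
move=> a; rewrite /split_mate; case aX: (a \in cover X.2); first by rewrite aX.
by rewrite mate_blob aX mateK //; exact: blobTL.
Qed.

Lemma split_mate_fix a : (split_mate X a == a) = (a \in cover X.2).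
Proof.
rewrite /split_mate; case: ifP => _; first by rewrite eqxx.
by apply/eqP; exact: (mate_neq blobTL).
Qed.

End Split.

(** Combines two conditions in boundary order: arcs do not cross, and no fixed point lies under an
    arc. *)
Definition nested s := forall a b, pos a < pos b -> pos b < pos (s a) ->
  [/\ pos a < pos (s b), pos (s b) < pos (s a) & s b <> b].

Lemma split_mate_nested X : nested (split_mate X).
Proof.
have tX := blobTL X.
move=> a b ab bs.
have aX : a \notin cover X.2.
  by apply/negP; rewrite -split_mate_fix => /eqP E; move: bs; rewrite E; lia.
move: bs; rewrite /split_mate (negbTE aX) => bs.
case: ifP => [bX|_]; first by case: (blob_exposed bX ab bs).
split; last exact: mate_neq.
  rewrite ltnNge leq_eqVlt; apply/negP=> /orP[/eqP/(@pos_inj n) E|lt].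
    by move: bs; rewrite -E mateK //; lia.
  by apply: (TLnc tX lt); rewrite mateK.
rewrite ltnNge leq_eqVlt; apply/negP=> /orP[/eqP/(@pos_inj n)/(inv_inj (mateK tX)) E|lt].
  by move: ab; rewrite E ltnn.
exact: (TLnc tX ab bs lt).
Qed.

Definition split_blobs X : partition_monoid n :=
  PartitionMonoid (pairing_partition (@split_mateK X)).

(** The fixed points of the involution are the blobbed endpoints, and elsewhere it agrees with the
    mates; what remains is to recover how the blobbed endpoints were paired. *)
Lemma split_blobs_inj : injective split_blobs.
Proof.
move=> X Y /(congr1 val) /= E.
have tX := blobTL X; have tY := blobTL Y.
have Es a : split_mate X a = split_mate Y a.
  have ba : (split_mate Y a == a) || (split_mate Y a == split_mate X a).
    rewrite -(in_pblock_pairing (@split_mateK X)) E in_pblock_pairing ?eqxx ?orbT //.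
    exact: split_mateK.
  case/orP: ba => /eqP // Ea.
  (* Here the block of [a] is a singleton, so [split_mate X a] is [a] as well. *)
  have := in_pblock_pairing (@split_mateK Y) a (split_mate X a).
  rewrite -E in_pblock_pairing ?eqxx ?orbT; last exact: split_mateK.
  by rewrite Ea orbb => /esym/eqP.
have Ec a : (a \in cover X.2) = (a \in cover Y.2) by rewrite -!split_mate_fix Es.
have Em a : mate X.1 a = mate Y.1 a.
  (* At the first boundary point where the mates differ both arcs go forward,
     and the longer one would cover a blobbed point. *)
  have [k] := ubnP (pos a); elim: k a => // k IH a ak.
  have := Es a; rewrite /split_mate -Ec; case: ifP => // aX _.
  have small (Z : blob_monoid n) : pos (mate Z.1 a) < pos a \/ pos a < pos (mate Z.1 a).
    case: ltngtP; [by left | by right |].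
    by move/(@pos_inj n)/(mate_neq (blobTL Z)).
  case: (small X) => ltX.
    have := IH (mate X.1 a); rewrite mateK // => H.
    by rewrite [in RHS]H ?mateK //; lia.
  case: (small Y) => ltY.
    have := IH (mate Y.1 a); rewrite [in RHS]mateK // => H.
    by rewrite -[in LHS]H ?mateK //; lia.
  case: (ltngtP (pos (mate X.1 a)) (pos (mate Y.1 a))) => [lt|lt|/pos_inj //].
    by case: (@blob_exposed Y a (mate X.1 a)) => //; rewrite -Ec mate_blob.
  by case: (@blob_exposed X a (mate Y.1 a)) => //; rewrite Ec mate_blob -Ec.
have E1 : X.1 = Y.1.
  rewrite -(pairing_mate tX) -(pairing_mate tY).
  by apply: eq_imset => a; rewrite Em.
apply: val_inj; rewrite /= [LHS]surjective_pairing [RHS]surjective_pairing E1.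
congr (_, _); apply: (blobs_ext (TLp tX)) => //; first exact: blob_sub.
by rewrite E1; exact: blob_sub.
Qed.

End Pairing.

(** * The cutting map respects products and generators *)

Section SplitMorphism.
Variable n : nat.
Implicit Types (X Y : blob_monoid n) (a b c : pt n).

Section Product.
Variables X Y : blob_monoid n.
Let tX := blobTL X.
Let tY := blobTL Y.
Let e := stack_edge X.1 Y.1.
Let e' := stack_edge (pairing (split_mate X)) (pairing (split_mate Y)).
Let pX := pairing_partition (@split_mateK n X).
Let pY := pairing_partition (@split_mateK n Y).

(** With [split_lower], the cut versions of [fP] and [gQ], whose alternation runs along the chains
    of the stacked graph. *)
Definition split_upper (x : stk n) : stk n :=
  match x with inl a => upper (split_mate X a) | inr i => inr i end.
Definition split_lower (x : stk n) : stk n :=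
  match x with inl (inl i) => inl (inl i)
  | inl (inr i) => lower (split_mate Y (inl i))
  | inr i => lower (split_mate Y (inr i)) end.

Lemma split_upper_or v : split_upper v = v \/ split_upper v = fP X.1 v.
Proof.
case: v => [a|i] /=; last by left.
by rewrite /split_mate; case: ifP; [left | right].
Qed.

Lemma split_lower_lower a : split_lower (lower a) = lower (split_mate Y a).
Proof. by case: a. Qed.

Lemma split_lower_or v : split_lower v = v \/ split_lower v = gQ Y.1 v.
Proof.
case: (stkP v) => [[i ->]|[a ->]]; first by left.
rewrite split_lower_lower gQ_lower /split_mate.
by case: ifP; [left | right].
Qed.

Lemma split_edge u v : e' u v -> v = u \/ v = split_upper u \/ v = split_lower u.
Proof.
case/(stack_edgeP _ _ pX pY)=> -[a [b [-> ->]]];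
  rewrite (in_pblock_pairing, in_pblock_pairing) => [|//]; try exact: split_mateK.
  by case/orP=> /eqP->; auto.
by case/orP=> /eqP->; auto; rewrite split_lower_lower; auto.
Qed.

Lemma split_edge_sym : symmetric e'.
Proof.
move=> x y; rewrite /e' /stack_edge; congr (_ || _);
  by apply: eq_existsb => A; rewrite [X in _ && X]andbC.
Qed.

Lemma split_edge_sub u v : connect e' u v -> connect e u v.
Proof.
apply: connect_sub => x y /split_edge[->|[->|->]]; first exact: connect0.
  by have [H _] := fg_e tX tY x; case: (split_upper_or x) => ->; rewrite ?connect0.
by have [_ H] := fg_e tX tY x; case: (split_lower_or x) => ->; rewrite ?connect0.
Qed.

(** The chain of an unblobbed arc of the product contains no blobbed piece, so none of its links is
    cut. *)
Lemma split_edge_unblobbed a v : a \notin cover (X * Y)%g.2 -> connect e (outer a) v ->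
  connect e' (outer a) v.
Proof.
move=> aN; have /negP H := aN.
have nX c : connect e (outer a) (upper c) -> c \notin cover X.2.
  move=> ac; apply/negP => cX; apply: H.
  by apply/mem_cover_blobsP; [exact: TLp | exact: TLp | exact: blob_sub |
    exact: blob_sub | left; exists c].
have nY c : connect e (outer a) (lower c) -> c \notin cover Y.2.
  move=> ac; apply/negP => cX; apply: H.
  by apply/mem_cover_blobsP; [exact: TLp | exact: TLp | exact: blob_sub |
    exact: blob_sub | right; exists c].
case/connectP=> p; elim/last_ind: p v => [|p w IH] v /=; first by move=> _ ->; exact: connect0.
rewrite rcons_path last_rcons => /andP[pp pw] ->.
apply: connect_trans (IH _ pp erefl) _.
have al : connect e (outer a) (last (outer a) p) by apply/connectP; exists p.
move: al pw; move: (last _ p) => u au.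
case/(stack_edgeP _ _ (TLp tX) (TLp tY))=> -[c [d [Eu -> cd]]]; rewrite Eu in au *.
  apply: stack_edge_upper => //; rewrite in_pblock_pairing; last exact: split_mateK.
  by rewrite /split_mate (negbTE (nX _ au)) -in_pblock_mate.
apply: stack_edge_lower => //; rewrite in_pblock_pairing; last exact: split_mateK.
by rewrite /split_mate (negbTE (nY _ au)) -in_pblock_mate.
Qed.

(** If the two ends stayed connected, [unsplit_component] would leave every link of the chain uncut,
    although one of them carries a blob. *)
Lemma split_edge_blobbed a b : a \in cover (X * Y)%g.2 -> connect e' (outer a) (outer b) -> b = a.
Proof.
move=> aB ab; apply/eqP; apply: contraTT aB => ba.
have fixo c : fP X.1 (outer c) = outer c \/ gQ Y.1 (outer c) = outer c.
  by case: c => i; [right | left].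
have ab' : outer a != outer b by rewrite (inj_eq (@outer_inj n)) eq_sym.
have G := unsplit_component split_upper_or split_lower_or (e_fg tX tY)
  split_edge split_edge_sym ab' ab (fixo a) (fixo b).
apply/negP=> /mem_cover_blobsP; case; [exact: TLp | exact: TLp | exact: blob_sub | exact: blob_sub | |].
  move=> [c cX /G[+ _]]; rewrite /= /split_mate cX => -[] /esym.
  exact: mate_neq.
move=> [c cY /G[_]]; rewrite split_lower_lower gQ_lower => /lower_inj.
by rewrite /split_mate cY => /esym; exact: mate_neq.
Qed.

Lemma split_blobsM : split_blobs (X * Y)%g = (split_blobs X * split_blobs Y)%g.
Proof.
apply: val_inj => /=; apply: pairing_eq_partition;
  [exact: (@split_mateK n (X * Y)%g) | exact: stack_partition |].
move=> a b; rewrite in_pblock_stack -/e'.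
have tXY := blobTL (X * Y)%g.
have cE : connect e (outer a) (outer b) = (b == a) || (b == mate (X * Y)%g.1 a).
  by rewrite -in_pblock_mate // in_pblock_stack.
rewrite /split_mate; case: ifP => aB.
  rewrite orbb; apply/idP/eqP => [|->]; [exact: split_edge_blobbed | exact: connect0].
rewrite -cE; apply/idP/idP; first exact: split_edge_sub.
by apply: split_edge_unblobbed; rewrite aB.
Qed.

End Product.

Lemma split_blobs1 : split_blobs (1%g : blob_monoid n) = 1%g.
Proof.
apply: val_inj => /=; rewrite -[RHS]pairing_mate; last exact: id_TL.
by apply: eq_imset => a; rewrite /split_mate /= /cover big_set0 inE.
Qed.

Lemma split_blobs_gen (i : 'I_n) : split_blobs (blob_gen i) = motzkin_gen i.
Proof.
apply: val_inj => /=; rewrite /blob_gen_diagram /motzkin_gen_blocks.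
have := split_mateK (blob_gen i); rewrite /= /blob_gen_diagram.
case: eqP => [i0|/eqP i0] sK; last first.
  rewrite -[RHS]pairing_mate; last exact: hook_TL.
  by apply: eq_imset => a; rewrite /split_mate /= /cover big_set0 inE.
apply: pairing_eq_partition => //; first exact: cut_partition.
move=> a b.
have -> : split_mate (id_diagram n, [set [set inl i; inr i]]) a =
  if idx a == i then a else mate (id_diagram n) a.
  by rewrite /split_mate /= cover1 id_blockP.
case: (eqVneq (idx a) i) => ai.
  have -> : pblock (cut i) a = [set a]; last by rewrite orbb inE.
  apply: partT_eq; rewrite ?inE ?eqxx //; first exact: cut_partition.
  by rewrite -ai; case: (a) => k /=; rewrite ?eqxx ?orbT.
rewrite -in_pblock_mate ?pblock_id; last exact: id_TL.
have -> : pblock (cut i) a = [set inl (idx a); inr (idx a)]; last by rewrite id_blockP.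
apply: partT_eq; [exact: cut_partition | | by rewrite id_blockP].
rewrite inE; apply/orP; right; apply/imsetP; exists (idx a) => //.
by rewrite inE.
Qed.

End SplitMorphism.

(** * Parity, monotone maps and comparison of sums *)

Lemma even_fixpoint_free (T : finType) (s : T -> T) (A : {set T}) : involutive s ->
  (forall a, a \in A -> s a \in A /\ s a != a) -> ~~ odd #|A|.
Proof.
move=> sK; have [k] := ubnP #|A|; elim: k A => // k IH A Ak cA.
have [->|[x xA]] := set_0Vmem A; first by rewrite cards0.
have [sxA sx] := cA _ xA.
have sxA' : s x \in A :\ x by rewrite !inE sx.
have E := cardsD1 x A; have E' := cardsD1 (s x) (A :\ x).
rewrite xA in E; rewrite sxA' in E'.
suff : ~~ odd #|A :\ x :\ s x| by lia.
apply: IH => [|a]; first by lia.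
rewrite !inE => /and3P[a1 a2 aA]; have [saA sa] := cA _ aA.
by rewrite saA sa (inj_eq (inv_inj sK)) a2 (inv_eq sK) a1.
Qed.

(** Upward induction from 0 gives [k <= g k], downward induction from [n - 1] gives [g k <= k]. *)
Lemma increasing_id n (g : nat -> nat) : (forall k, k < n -> g k < n) ->
  (forall k l, k < l -> l < n -> g k < g l) -> forall k, k < n -> g k = k.
Proof.
move=> gn gi.
have lo k : k < n -> k <= g k.
  elim: k => // k IH kn; have := IH (ltnW kn); have := gi k k.+1 (ltnSn k) kn; lia.
have hi d k : k < n -> n - k.+1 = d -> g k <= k.
  elim: d k => [|d IH] k kn E; first by have := gn _ kn; lia.
  have kn' : k.+1 < n by lia.
  have := IH k.+1 kn' ltac:(lia); have := gi k k.+1 (ltnSn k) kn'; lia.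
by move=> k kn; apply/eqP; rewrite eqn_leq lo // (hi _ _ kn erefl).
Qed.

(** Reduces the comparison of two widths to the few points changed by a peeling step. *)
Lemma sum_lt (T : finType) (F G : T -> nat) (r : seq T) : uniq r ->
  (forall x, x \notin r -> F x = G x) ->
  \sum_(x <- r) F x < \sum_(x <- r) G x -> \sum_x F x < \sum_x G x.
Proof.
move=> U E lt; rewrite (bigID (mem r)) [X in _ < X](bigID (mem r)) /=.
by rewrite -!big_uniq // [X in _ + X](eq_bigr G) // ltn_add2r.
Qed.

(** * Peeling generators off nested involutions *)

Section Peeling.
Variable n : nat.
Implicit Types (a b c x y : pt n) (s : pt n -> pt n) (i k l : 'I_n).


(* The first strand met when walking along the boundary from the top point [i]
   through the points right of the vertical line before [i], among those
   crossing that line or ending in a fixed point. One exists since the number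
   of points right of the line, [inl i] excluded, is odd. *)
Lemma exists_crossing s i : involutive s ->
  exists b, [/\ i <= idx b, b != inl i,
    [\/ s b = b, idx (s b) < i | s b = inl i] &
    forall c, i <= idx c -> c != inl i -> pos c < pos b ->
      [/\ s c <> c, i <= idx (s c) & s c != inl i]].
Proof.
move=> sK; pose A := [set c : pt n | (i <= idx c) && (c != inl i)].
have oA : odd #|A|.
  pose sw (c : pt n) : pt n := match c with inl k => inr k | inr k => inl k end.
  have ev : ~~ odd #|[set c : pt n | i <= idx c]|.
    apply: (@even_fixpoint_free _ sw) => [[]//|[] k]; rewrite !inE //.
  have := cardsD1 (inl i) [set c : pt n | i <= idx c]; rewrite inE leqnn.
  suff -> : [set c : pt n | i <= idx c] :\ inl i = A by lia.
  by apply/setP=> c; rewrite !inE andbC.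
pose bad c := [&& i <= idx c, c != inl i & (s c == c) || (s c \notin A)].
have [b0 bb0] : exists b, bad b.
  (* Without a bad point, [s] would pair up the points of [A], whose number is odd. *)
  apply/existsP; apply: contraLR oA => /existsPn H.
  apply: (even_fixpoint_free sK) => c; rewrite inE => /andP[c1 c2].
  by have := H c; rewrite /bad c1 c2 /= negb_or negbK => /andP[].
case: (arg_minnP (@pos n) bb0) => b /and3P[b1 b2 b3] bmin.
exists b; split=> //.
  case/orP: b3 => [/eqP|]; first by constructor 1.
  rewrite inE negb_and negbK -ltnNge => /orP[|/eqP]; first by constructor 2.
  by constructor 3.
move=> c c1 c2 cb; have : ~~ bad c by apply/negP=> /bmin; lia.
rewrite /bad c1 c2 /= negb_or negbK inE => /andP[/eqP sc /andP[]].
by split.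
Qed.

Lemma idx_pos a : (idx a : nat) = if pos a < n then pos a else n + n - (pos a).+1.
Proof. by case: a => i /=; have := ltn_ord i; case: ifP; lia. Qed.

Lemma pos_lt a : pos a < n + n.
Proof. by case: a => i /=; have := ltn_ord i; lia. Qed.

Lemma pos_eqF a b : a <> b -> pos a <> pos b.
Proof. by move=> ab /(@pos_inj n). Qed.

Section Reroute.
Variables (s : pt n -> pt n) (j b : pt n).
Hypothesis sK : involutive s.

(* For [s j = r], the blocks {j, r}, {b, s b} become {j, s b}, {r, b}; a fixed
   point [b] leaves [j] fixed. *)
Definition reroute x : pt n := tperm j b (s (tperm j b x)).

Lemma rerouteK : involutive reroute.
Proof. by move=> x; rewrite /reroute tpermK sK tpermK. Qed.

Hypothesis sj : s j <> j.
Hypothesis bj : b <> j.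
Hypothesis bsj : b <> s j.

Lemma reroute_sj : reroute (s j) = b.
Proof.
rewrite /reroute (tpermD (z := s j)) ?sK ?tpermL //; apply/eqP=> //.
by move/esym.
Qed.

Lemma reroute_b : reroute b = s j.
Proof. by rewrite /reroute tpermR tpermD //; apply/eqP=> // /esym. Qed.

Lemma reroute_j : reroute j = if s b == b then j else s b.
Proof.
rewrite /reroute tpermL; case: eqP => [->|sb]; first by rewrite tpermR.
rewrite tpermD //; apply/eqP => // E; last by case: sb.
by apply: bsj; rewrite E sK.
Qed.

Lemma reroute_sb : s b <> b -> reroute (s b) = j.
Proof.
move=> sb; rewrite /reroute (tpermD (z := s b)) ?sK ?tpermR //; apply/eqP.
  by move=> E; apply: bsj; rewrite E sK.
by move/esym.
Qed.

Lemma reroute_other x : x <> j -> x <> s j -> x <> b -> x <> s b -> reroute x = s x.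
Proof.
move=> xj xsj xb xsb; rewrite /reroute (tpermD (z := x)); try by apply/eqP=> /esym.
rewrite tpermD //; apply/eqP=> E.
  by apply: xsj; rewrite E sK.
by apply: xsb; rewrite E sK.
Qed.

End Reroute.

(** * Peeling off a generator of positive index *)

Section Hook.
Variables (s : pt n -> pt n) (i : 'I_n) (b : pt n).
Hypotheses (sK : involutive s) (i0 : i != 0 :> nat).
Let j : pt n := inl (Defs.prev i).
Let r : pt n := inl i.
Hypothesis sj : s j = r.
Hypotheses (ib : i <= idx b) (br : b != r).
Hypothesis sb : s b = b \/ idx (s b) < i.

Let posj : pos j = i.-1. Proof. by []. Qed.
Let posr : pos r = i. Proof. by []. Qed.
Let sr : s r = j. Proof. by rewrite -sj sK. Qed.
Let jr : j <> r. Proof. by move/(congr1 (@pos n)); rewrite posj posr; lia. Qed.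
Let bj : b <> j.
Proof. by move=> E; move: ib; rewrite E /=; lia. Qed.
Let br' : b <> r. Proof. exact/eqP. Qed.
Let sjj : s j <> j. Proof. by rewrite sj => /esym. Qed.
Let bsj : b <> s j. Proof. by rewrite sj. Qed.
Let s' := reroute s j b.

Lemma hook_reroute_stack : stack (hook i) (pairing s') = pairing s.
Proof.
have s'K : involutive s' by exact: rerouteK.
(* The middle points below [j] and [r] are spliced into the strand of [b], so they go to [b]; any
   other middle point goes to the top point above it. *)
pose F (x : stk n) : pt n := match x with
  | inl (inr k) => if (k == Defs.prev i) || (k == i) then b else inl k
  | inl (inl k) => inl k | inr k => inr k end.
have pS := pairing_partition sK.
have pH := hook_partition i0.
have Flow x : F (lower x) = if (x == j) || (x == r) then b else x.
  by case: x => k.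
have inH A x y : A \in hook i -> x \in A -> y \in A -> y \in pblock (hook i) x.
  by move=> AH xA yA; rewrite (partT_eq pH AH xA).
apply: (@stack_eq _ _ _ _ F) => //; first exact: pairing_partition.
- by case.
- move=> x y xy; have [xx xH] := partT_in x pH; rewrite in_pblock_pairing //.
  move: xH xx xy; move: (pblock _ x) => A; rewrite inE => /orP[].
    rewrite !inE => /orP[]/eqP->; rewrite !inE => /orP[]/eqP-> /orP[]/eqP->;
      rewrite /= ?eqxx ?orbT //=; by rewrite -?/j -?/r ?sj ?sr eqxx ?orbT.
  case/imsetP=> k; rewrite inE => /andP[/negbTE k1 /negbTE k2] ->.
  by rewrite !inE => /orP[]/eqP-> /orP[]/eqP-> /=; rewrite ?k1 ?k2 /= eqxx.
- move=> x y; rewrite !in_pblock_pairing // !Flow => /orP[]/eqP->; first by rewrite eqxx.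
  case: (eqVneq x r) => [->|/eqP xr].
    rewrite -sj /s' reroute_sj // sj.
    by rewrite orbT if_same eqxx.
  case: (eqVneq x j) => [->|/eqP xj] /=.
    rewrite /s' reroute_j //; case: (s b =P b) => E; first by rewrite eqxx /= eqxx.
    case: ifP; first by rewrite eqxx.
    by rewrite eqxx orbT.
  case: (eqVneq x b) => [->|/eqP xb].
    by rewrite /s' reroute_b // sj eqxx orbT eqxx.
  case: (eqVneq x (s b)) => [E|/eqP xsb].
    have sb' : s b <> b by rewrite -E.
    by rewrite E /s' reroute_sb // eqxx /= sK eqxx orbT.
  rewrite /s' reroute_other // ?sj //.
  rewrite (introF (s x =P j)) => [|E]; last by apply: xr; rewrite -sj -E sK.
  rewrite (introF (s x =P r)) => [|E]; last by apply: xj; rewrite -sr -E sK.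
  by rewrite eqxx orbT.
- have vert x : x <> j -> x <> r -> connect (stack_edge (hook i) (pairing s')) (outer x) (lower x).
    case: x => k xj xr; last exact: connect0.
    apply: (@stack_edge_upper _ _ _ (inl k) (inr k)) => //.
    apply: (inH [set inl k; inr k]); rewrite ?inE ?eqxx ?orbT //.
    apply/orP; right; apply: imset_f; rewrite inE.
    by apply/andP; split; apply/eqP=> E; [apply: xj | apply: xr]; rewrite E.
  have low x y : y = s' x -> connect (stack_edge (hook i) (pairing s')) (lower x) (lower y).
    move=> ->; apply: stack_edge_lower; first exact: pairing_partition.
    by rewrite in_pblock_pairing // eqxx orbT.
  have top : connect (stack_edge (hook i) (pairing s')) (outer j) (outer r).
    apply: (@stack_edge_upper _ _ _ j r) => //.
    by apply: (inH [set j; r]); rewrite ?inE ?eqxx ?orbT.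
  have mid : connect (stack_edge (hook i) (pairing s')) (lower j) (lower r).
    apply: (@stack_edge_upper _ _ _ (inr (Defs.prev i)) (inr i)) => //.
    by apply: (inH [set inr (Defs.prev i); inr i]); rewrite ?inE ?eqxx ?orbT.
  (* The route descends from [b], follows the new arc to [r], crosses the bottom arc of the hook to
     [j] and returns along the other new arc to [s b]. *)
  have bsb : s b <> b -> connect (stack_edge (hook i) (pairing s')) (outer b) (outer (s b)).
    move=> E; apply: connect_trans (vert _ bj br') _.
    apply: connect_trans (low b r _) _; first by rewrite /s' reroute_b // sj.
    rewrite stack_edge_sym; apply: connect_trans (vert (s b) _ _) _.
    - by move=> E'; apply: bsj; rewrite -E' sK.
    - by move=> E'; apply: bj; rewrite -sr -E' sK.
    by apply: connect_trans (low _ j _) mid; rewrite /s' reroute_sb.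
  move=> x y; rewrite in_pblock_pairing // => /orP[]/eqP->; first exact: connect0.
  case: (eqVneq x r) => [->|/eqP xr]; first by rewrite sr stack_edge_sym.
  case: (eqVneq x j) => [->|/eqP xj]; first by rewrite sj.
  case: (eqVneq x b) => [->|/eqP xb].
    by case: (s b =P b) => [->|]; [exact: connect0 | exact: bsb].
  case: (eqVneq x (s b)) => [E|/eqP xsb].
    by rewrite E sK stack_edge_sym; apply: bsb; rewrite -E.
  apply: connect_trans (vert _ xj xr) _; rewrite stack_edge_sym.
  apply: connect_trans (vert _ _ _) _.
  - by move=> E; apply: xr; rewrite -sj -E sK.
  - by move=> E; apply: xj; rewrite -sr -E sK.
  by rewrite stack_edge_sym; apply: low; rewrite /s' reroute_other ?sj.
Qed.

Hypothesis ns : nested s.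
Hypothesis bmin : forall c, i <= idx c -> c != r -> pos c < pos b ->
  [/\ s c <> c, i <= idx (s c) & s c != r].

Lemma crossing_gt : i < pos b.
Proof.
have := pos_eqF br'; rewrite posr; move: ib; rewrite idx_pos.
have := pos_lt b; have := ltn_ord i; case: ifP; lia.
Qed.

(** The ranks strictly between [r] and [b] form a closed pocket. By minimality of [b], partners of
    its points stay right of the line; a partner beyond [b] would enclose both [b] and [s b],
    keeping [s b] right of the line too. *)
Lemma crossing_closed c : i < pos c -> pos c < pos b ->
  [/\ i < pos (s c), pos (s c) < pos b & s c <> c].
Proof.
move=> ic cb.
have ci : i <= idx c.
  by move: ib; rewrite !idx_pos; have := pos_lt b; have := ltn_ord i; do 2 case: ifP; lia.
have cr : c != r by apply/eqP=> E; move: ic; rewrite E posr ltnn.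
have [scc isc /eqP scr] := bmin ci cr cb; split=> //.
  have := pos_eqF scr; rewrite posr; move: isc; rewrite idx_pos.
  have := pos_lt (s c); have := ltn_ord i; case: ifP; lia.
rewrite ltnNge leq_eqVlt; apply/negP=> /orP[/eqP/(@pos_inj n) E|lt].
  by case: sb; rewrite E sK => E'; [rewrite -E' in E; case: scc | lia].
have [lo hi sbb] := ns cb lt.
case: sb => // lti; move: isc lti; rewrite !idx_pos.
have := pos_lt (s b); have := ltn_ord i; have := pos_lt (s c); do 2 case: ifP; lia.
Qed.

(** A partner left of the line is a top point before [j] or a bottom point; the latter has larger
    rank than every point right of the line. *)
Lemma crossing_image : [\/ s b = b, pos (s b) < i.-1 | pos b < pos (s b)].
Proof.
case: sb => [|lti]; first by constructor 1.
have sbj : s b <> j by move=> E; apply: br'; rewrite -sj -E sK.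
have := pos_eqF sbj; rewrite posj.
have [lt|ge] := ltnP (pos (s b)) i.-1; first by constructor 2.
constructor 3; move: lti ib; rewrite !idx_pos.
have := pos_lt (s b); have := pos_lt b; have := ltn_ord i; do 2 case: ifP; lia.
Qed.

(** Only the closed pocket separates [r] from [b], so the arc joining them crosses nothing, and [j]
    can take over the role of [b]. The cases place [x], then [y], among [j], [r], [b] and [s b]. *)
Lemma reroute_nested : nested s'.
Proof.
have ib' := crossing_gt; have In := crossing_closed; have Im := crossing_image.
have ssb : s (s b) = b by rewrite sK.
have rr : s' r = b by rewrite /s' -sj reroute_sj.
have rb : s' b = r by rewrite /s' reroute_b.
have rj : s' j = if s b == b then j else s b by rewrite /s' reroute_j.
have rsb : s b <> b -> s' (s b) = j by move=> E; rewrite /s' reroute_sb.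
have ro x : x <> j -> x <> r -> x <> b -> x <> s b -> s' x = s x.
  by move=> ? ? ? ?; rewrite /s' reroute_other ?sj.
have sbr : s b <> r by move=> E; apply: bj; rewrite -sr -E sK.
have sbj : s b <> j by move=> E; apply: br'; rewrite -sj -E sK.
have P x y : x <> y -> pos x <> pos y by exact: pos_eqF.
move=> x y xy.
case: (x =P r) => [xr|xr].
  rewrite xr rr posr => yb; rewrite xr posr in xy.
  have yr : y <> r by move=> E; rewrite E posr ltnn in xy.
  have yj : y <> j by move=> E; rewrite E posj in xy; lia.
  have yB : y <> b by move=> E; rewrite E ltnn in yb.
  have [h1 h2 h3] := In _ xy yb.
  have ysb : y <> s b by move=> E; rewrite E ssb ltnn in h2.
  by rewrite ro.
case: (x =P b) => [xb|xb].
  by rewrite xb rb posr => yb; rewrite xb in xy; lia.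
case: (x =P j) => [xj|xj].
  rewrite xj rj posj; rewrite xj posj in xy; case: eqP => sbb; first by rewrite posj; lia.
  move=> ya; have lo : pos b < pos (s b) by case: Im => //; lia.
  case: (y =P r) => [->|yr]; first by rewrite rr; split=> //; lia.
  case: (y =P b) => [->|yb]; first by rewrite rb posr; split=> //; [lia | lia | exact/nesym].
  have yj : y <> j by move=> E; rewrite E posj in xy; lia.
  have ysb : y <> s b by move=> E; rewrite E ltnn in ya.
  rewrite ro //; have := P _ _ yr; have := P _ _ yb; rewrite posr => n1 n2.
  case: (ltnP (pos y) (pos b)) => [lt|ge].
    by case: (In y) => [||h1 h2 h3]; try split=> //; lia.
  by case: (ns (a := b) (b := y)) => [||h1 h2 h3]; try split=> //; lia.
case: (x =P s b) => [xs|xs].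
  have sbb : s b <> b by rewrite -xs.
  rewrite xs rsb // posj; rewrite xs in xy => yj'.
  have yj : y <> j by move=> E; rewrite E posj ltnn in yj'.
  have yr : y <> r by move=> E; rewrite E posr in yj'; lia.
  have yb : y <> b by move=> E; rewrite E in yj'; lia.
  have ysb : y <> s b by move=> E; rewrite E ltnn in xy.
  rewrite ro //; case: (ns xy); rewrite ?ssb; first by lia.
  move=> h1 h2 h3; split=> //.
  have syj : s y <> j by move=> E; apply: yr; rewrite -sj -E sK.
  have syr : s y <> r by move=> E; apply: yj; rewrite -sr -E sK.
  have := P _ _ syj; have := P _ _ syr; rewrite posj posr => n1 n2.
  rewrite ltnNge; apply/negP=> ge.
  by case: (In (s y)); rewrite ?sK; lia.
rewrite (ro x) // => ysx.
have sxr : s x <> r by move=> E; apply: xj; rewrite -sr -E sK.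
have sxj : s x <> j by move=> E; apply: xr; rewrite -sj -E sK.
have sxb : s x <> b by move=> E; apply: xs; rewrite -E sK.
(* Since the pocket is closed, an unmoved arc over [r] also passes over [b], and one over [b] starts
   before [j]. *)
have K1 : pos x < i -> i < pos (s x) -> pos b < pos (s x).
  move=> xi isx; rewrite ltnNge leq_eqVlt; apply/negP=> /orP[/eqP/(@pos_inj n)//|lt].
  by case: (In (s x)) => // h1 _ _; rewrite sK in h1; lia.
have K2 : pos x < pos b -> pos b < pos (s x) -> pos x < i.-1.
  move=> lb bs; have := P _ _ xr; have := P _ _ xj; rewrite posr posj => n1 n2.
  rewrite ltnNge; apply/negP=> ge.
  by case: (In x) => [||h1 h2 h3]; lia.
have := P _ _ sxj; have := P _ _ sxr; have := P _ _ xr; have := P _ _ xj.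
rewrite posr posj => n1 n2 n3 n4.
case: (y =P j) => [yj|yj].
  rewrite yj posj in xy ysx; rewrite yj rj.
  have bx : pos b < pos (s x) by apply: K1; lia.
  case: (ns (a := x) (b := b)) => [||h1 h2 h3]; [lia | lia |].
  by case: eqP => // _; split.
case: (y =P r) => [yr|yr].
  rewrite yr posr in xy ysx; rewrite yr rr.
  have bx : pos b < pos (s x) by apply: K1; lia.
  by split=> //; lia.
case: (y =P b) => [yb|yb].
  rewrite yb in xy ysx; rewrite yb rb posr.
  have := K2 xy ysx => xi.
  by split; [lia | lia | exact/nesym].
case: (y =P s b) => [ysb|ysb].
  have sbb : s b <> b by rewrite -ysb.
  rewrite ysb in xy ysx; rewrite ysb rsb // posj.
  case: (ns xy ysx); rewrite ssb => h1 h2 h3.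
  have := K2 h1 h2 => xi.
  by split; [lia | lia | exact/nesym].
by rewrite ro //; exact: ns.
Qed.

End Hook.

(** * Peeling off the generator of index 0 *)

Section Cut.
Variables (s : pt n -> pt n) (i : 'I_n) (b : pt n).
Hypotheses (sK : involutive s) (i0 : i = 0 :> nat) (ns : nested s).
Let r : pt n := inl i.
Hypotheses (sr : s r = r) (br : b != r) (sb : s b = b).
Hypothesis bmin : forall c, c != r -> pos c < pos b -> s c <> c.

Definition join x : pt n := tperm r b (s x).

Let br' : b <> r. Proof. exact/eqP. Qed.
Let jr : join r = b. Proof. by rewrite /join sr tpermL. Qed.
Let jb : join b = r. Proof. by rewrite /join sb tpermR. Qed.
Let jo x : x <> r -> x <> b -> join x = s x.
Proof.
move=> xr xb; rewrite /join tpermD //; apply/eqP=> E.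
  by apply: xr; rewrite -sr E sK.
by apply: xb; rewrite -sb E sK.
Qed.

Lemma joinK : involutive join.
Proof.
move=> x; case: (x =P r) => [->|xr]; first by rewrite jr jb.
case: (x =P b) => [->|xb]; first by rewrite jb jr.
rewrite (jo xr xb) jo ?sK //.
  by move=> E; apply: xr; rewrite -sr -E sK.
by move=> E; apply: xb; rewrite -sb -E sK.
Qed.

Lemma cut_join_stack : stack (cut i) (pairing join) = pairing s.
Proof.
(* The middle point below [r] is cut from above and joined to [b] from below. *)
pose F (x : stk n) : pt n := match x with
  | inl (inr k) => if k == i then b else inl k
  | inl (inl k) => inl k | inr k => inr k end.
have pH := cut_partition i.
have Flow x : F (lower x) = if x == r then b else x by case: x => k.
apply: (@stack_eq _ _ _ _ F) => //; try exact: pairing_partition joinK.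
- exact: pairing_partition.
- by case.
- move=> x y xy; have [xx xH] := partT_in x pH; rewrite in_pblock_pairing //.
  move: xH xx xy; move: (pblock _ x) => A; rewrite inE => /orP[].
    by rewrite !inE => /orP[]/eqP->; rewrite !inE => /eqP-> /eqP->; rewrite eqxx.
  case/imsetP=> k; rewrite inE => /negbTE ki ->.
  by rewrite !inE => /orP[]/eqP-> /orP[]/eqP-> /=; rewrite ?ki eqxx.
- move=> x y; rewrite in_pblock_pairing; last exact: joinK.
  rewrite in_pblock_pairing // !Flow => /orP[]/eqP->; first by rewrite eqxx.
  case: (eqVneq x r) => [->|/eqP xr].
    by rewrite jr if_same eqxx.
  case: (eqVneq x b) => [->|/eqP xb]; first by rewrite jb eqxx eqxx.
  rewrite jo // (introF (s x =P r)) => [|E]; last by apply: xr; rewrite -sr -E sK.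
  by rewrite eqxx orbT.
- have vert x : x <> r -> connect (stack_edge (cut i) (pairing join)) (outer x) (lower x).
    case: x => k xr; last exact: connect0.
    apply: (@stack_edge_upper _ _ _ (inl k) (inr k)) => //.
    rewrite (@partT_eq _ _ [set inl k; inr k]) ?inE ?eqxx ?orbT //.
    apply/orP; right; apply: imset_f; rewrite inE.
    by apply/eqP=> E; apply: xr; rewrite E.
  move=> x y; rewrite in_pblock_pairing // => /orP[]/eqP->; first exact: connect0.
  case: (eqVneq x r) => [->|/eqP xr]; first by rewrite sr.
  case: (eqVneq x b) => [->|/eqP xb]; first by rewrite sb.
  apply: connect_trans (vert _ xr) _; rewrite stack_edge_sym.
  apply: connect_trans (vert _ _) _; first by move=> E; apply: xr; rewrite -sr -E sK.
  rewrite stack_edge_sym; apply: stack_edge_lower; first exact: pairing_partition joinK.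
  by rewrite in_pblock_pairing ?jo ?eqxx ?orbT //; exact: joinK.
Qed.

(** The new arc starts at rank 0 and has no fixed point under it by the choice of [b]; no old arc
    crosses it, because none passes over the fixed point [b]. *)
Lemma join_nested : nested join.
Proof.
have rmin c : c <> r -> 0 < pos c by move/pos_eqF; rewrite /= i0; lia.
have pr : pos r = 0 by [].
have bn c : pos c < pos b -> pos b < pos (s c) -> False.
  by move=> lt1 lt2; case: (ns lt1 lt2).
move=> x y; case: (x =P r) => [->|xr].
  rewrite jr pr => y0 yb.
  have yr : y <> r by move=> E; rewrite E pr in y0.
  have yB : y <> b by move=> E; rewrite E ltnn in yb.
  have nf : s y <> y by apply: bmin => //; exact/eqP.
  rewrite jo //; split=> //.
    by apply: rmin => E; apply: yr; rewrite -sr -E sK.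
  rewrite ltnNge leq_eqVlt; apply/negP=> /orP[/eqP/(@pos_inj n) E|]; last exact: bn.
  by apply: yB; rewrite -sb E sK.
case: (x =P b) => [->|xb]; first by rewrite jb pr.
rewrite (jo xr xb) => xy ys.
case: (y =P b) => [E|yb]; first by rewrite E in xy ys; case: (bn x).
case: (y =P r) => [E|yr]; first by rewrite E pr in xy.
by rewrite jo //; exact: ns.
Qed.

End Cut.

(* Every arc is counted from both its ends; a fixed point stands for half of an
   arc joining it to its mirror image behind the left wall. *)
Definition strand_width s x :=
  if s x == x then (idx x).*2.+1 else (idx x - idx (s x)) + (idx (s x) - idx x).
Definition width s := \sum_x strand_width s x.

(** With [k = idx b], the two fixed points contribute [1] and [2k + 1], the arc joining them only
    [2k]. *)
Lemma width_join s i b : involutive s -> i = 0 :> nat -> s (inl i) = inl i ->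
  b != inl i -> s b = b -> width (join s i b) < width s.
Proof.
move=> sK i0 sr br sb; apply: (@sum_lt _ _ _ [:: inl i; b]).
- by rewrite /= inE eq_sym br.
- move=> x; rewrite !inE negb_or => /andP[/eqP xr /eqP xb].
  have -> // : strand_width (join s i b) x = strand_width s x.
  rewrite /strand_width /join tpermD //; apply/eqP=> E.
    by apply: xr; rewrite -sr E sK.
  by apply: xb; rewrite -sb E sK.
- rewrite !big_cons !big_nil /strand_width /join sr sb !eqxx tpermL tpermR.
  by rewrite (negbTE br) eq_sym (negbTE br) /= i0; lia.
Qed.

(** The width drops by 4: the arc between [j] and [r] disappears, and so does the unit step of the
    strand of [b] across the line, each counting 2. *)
Lemma width_reroute s i b : involutive s -> i != 0 :> nat ->
  s (inl (Defs.prev i)) = inl i -> i <= idx b -> b != inl i -> s b = b \/ idx (s b) < i ->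
  width (reroute s (inl (Defs.prev i)) b) < width s.
Proof.
move=> sK i0 sj ib br' sb; set j : pt n := inl (Defs.prev i) in sj *.
set r : pt n := inl i in sj br'; have br : b <> r by apply/eqP.
have sr : s r = j by rewrite -sj sK.
have rj : r <> j by move/(congr1 (@pos n)) => /=; lia.
have bj : b <> j by move=> E; move: ib; rewrite E /=; lia.
have bsj : b <> s j by rewrite sj.
have sjj : s j <> j by rewrite sj.
have sbr : s b <> r by move=> E; apply: bj; rewrite -sr -E sK.
have sbj : s b <> j by move=> E; apply: br; rewrite -sj -E sK.
have Er : reroute s j b r = b by rewrite -sj reroute_sj.
have Eb := reroute_b sjj bsj; have Ej := reroute_j sK bsj.
have neq (x y : pt n) : x <> y -> (x == y) = false by move/eqP/negbTE.
have rest x : x <> j -> x <> r -> x <> b -> x <> s b ->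
    strand_width (reroute s j b) x = strand_width s x.
  by move=> ? ? ? ?; rewrite /strand_width reroute_other ?sj.
case: (s b =P b) sb => [sbb _|sbb [//|sbi]].
  apply: (@sum_lt _ _ _ [:: j; r; b]).
  - by rewrite /= !inE !negb_or !neq //; exact/nesym.
  - move=> x; rewrite !inE !negb_or => /and3P[/eqP ? /eqP ? /eqP ?].
    by apply: rest; rewrite ?sbb.
  - rewrite !big_cons !big_nil /strand_width Er Eb Ej sj sr sbb !eqxx.
    by rewrite !neq /=; try exact/nesym; rewrite // ?eqxx; lia.
have Esb := reroute_sb sK bsj sbb.
apply: (@sum_lt _ _ _ [:: j; r; b; s b]).
- by rewrite /= !inE !negb_or !neq //; exact/nesym.
- move=> x; rewrite !inE !negb_or => /and4P[/eqP ? /eqP ? /eqP ? /eqP ?].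
  exact: rest.
- rewrite !big_cons !big_nil /strand_width Er Eb Ej Esb sj sr sK (introF eqP sbb).
  by rewrite !neq /=; try exact/nesym; try done; lia.
Qed.

(** * Involutions that cannot be peeled, and membership in the generated monoid *)

Lemma increasing_ord_id (g : 'I_n -> 'I_n) : (forall k l, k < l -> g k < g l) -> g =1 id.
Proof.
(* The default 0 is harmless: [increasing_id] evaluates [G] only below [n]. *)
move=> gi k; pose G m := if insub m is Some l then g l : nat else 0.
have GE l : G l = g l by rewrite /G valK.
apply: val_inj => /=; rewrite -GE; apply: (@increasing_id n) => //.
- by move=> m mn; rewrite -[m]/(val (Ordinal mn)) GE.
- move=> m p mp pn; have mn := ltn_trans mp pn.
  rewrite -[m]/(val (Ordinal mn)) -[p]/(val (Ordinal pn)) !GE; exact: gi.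
Qed.

(** A top arc would contain shorter ones, down to one joining neighbours, which is excluded. So
    every top point runs to the bottom, and nesting makes this map of columns increasing. *)
Lemma nested_id s (z : 'I_n) : involutive s -> nested s -> z = 0 :> nat ->
  s (inl z) <> inl z -> (forall i, i != 0 :> nat -> s (inl (Defs.prev i)) <> inl i) ->
  pairing s = id_diagram n.
Proof.
move=> sK ns z0 nz na.
have tt k l : k < l -> s (inl k) <> inl l.
  have [d] := ubnP (l - k); elim: d k l => // d IH k l ld kl E.
  case: (eqVneq (l : nat) k.+1) => [E'|ne].
    by apply: (na l); [lia | rewrite -E; congr (s (inl _)); apply: val_inj; rewrite /= E'].
  have mn : k.+1 < n by have := ltn_ord l; lia.
  have [] := ns (inl k) (inl (Ordinal mn)); rewrite ?E /=; [lia | lia |].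
  case Em : (s _) => [p|p] /= h1 h2 h3; last by have := ltn_ord l; lia.
  apply: (IH (Ordinal mn) p) => //=; first by lia.
  have : (p : nat) <> k.+1 by move=> Ep; apply: h3; congr inl; apply: val_inj.
  lia.
have [l0 El0] : exists l, s (inl z) = inr l.
  case E : (s (inl z)) => [l|l]; last by exists l.
  have : (l : nat) <> z by move=> El; apply: nz; rewrite E; congr inl; apply: val_inj.
  by move=> lz; case: (tt z l) => //; lia.
(* The strand of [inl z] runs from rank 0 to the bottom row, so every other top point lies under it
   and cannot be fixed. *)
have tb k : exists l, s (inl k) = inr l.
  case: (eqVneq k z) => [->|kz]; first by exists l0.
  case E : (s (inl k)) => [l|l]; last by exists l.
  have kz' : (k : nat) <> z by move=> Ek; move/eqP: kz; apply; exact: val_inj.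
  have [] := ns (inl z) (inl k); rewrite ?El0 /=; [lia | have := ltn_ord k; lia |].
  rewrite E /= => _ _ lk; case: (ltngtP k l) => [lt|gt|/val_inj E'].
  - by case: (tt _ _ lt).
  - by case: (tt _ _ gt); rewrite -E sK.
  - by case: lk; rewrite E'.
pose g k := idx (s (inl k)).
have sg k : s (inl k) = inr (g k) by rewrite /g; case: (tb k) => l ->.
have gE : g =1 id.
  apply: increasing_ord_id => k l kl.
  have [] := ns (inl k) (inl l); rewrite ?sg //=; first by have := ltn_ord l; lia.
  by have := ltn_ord (g k); have := ltn_ord (g l); lia.
have st k : s (inl k) = inr k by rewrite sg gE.
have sbt k : s (inr k) = inl k by rewrite -st sK.
apply: pairing_eq_partition => //; first exact: id_partition.
by move=> [k|k] [l|l]; rewrite pblock_id ?st ?sbt -!sum_eqE /= ?orbF.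
Qed.

Lemma motzkin_gen_in i : motzkin_gen i \in motzkin_blob_set n.
Proof. by apply/bigcapP=> S /andP[_ /forallP]. Qed.

Lemma nested_in_motzkin s (sK : involutive s) : 0 < n -> nested s ->
  PartitionMonoid (pairing_partition sK) \in motzkin_blob_set n.
Proof.
move=> n0; have [d] := ubnP (width s); elim: d s sK => // d IH s sK wd ns.
have [M1 MM] := motzkin_blob_closed n.
pose z := Ordinal n0.
have step i s' (s'K : involutive s') : width s' < width s -> nested s' ->
    stack (motzkin_gen_blocks i) (pairing s') = pairing s ->
    PartitionMonoid (pairing_partition sK) \in motzkin_blob_set n.
  move=> w' ns' E.
  have -> : PartitionMonoid (pairing_partition sK) =
      (motzkin_gen i * PartitionMonoid (pairing_partition s'K))%g.
    by apply: val_inj; rewrite /= E.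
  by apply: MM; rewrite inE; [exact: motzkin_gen_in | apply: IH => //; lia].
case: (s (inl z) =P inl z) => [sz|sz].
  have [b [_ bz sb bmin]] := exists_crossing z sK.
  have {}sb : s b = b.
    by case: sb => // E; case/eqP: bz; rewrite -sz -E sK.
  have bmin' c : c != inl z -> pos c < pos b -> s c <> c by move=> c1 c2; case: (bmin c).
  apply: (step z (join s z b)); first exact: joinK.
  - exact: width_join.
  - exact: join_nested.
  - exact: cut_join_stack.
case: (boolP [exists i : 'I_n, (i != 0 :> nat) && (s (inl (Defs.prev i)) == inl i)]) => [|H].
  case/existsP=> i /andP[i0 /eqP sj].
  have [b [ib br sb bmin]] := exists_crossing i sK.
  (* The partner of [inl i] is the top point just left of the line, so it is not [b]. *)
  have {}sb : s b = b \/ idx (s b) < i.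
    case: sb => [|| E]; [by left | by right |].
    by move: ib; rewrite -(sK b) E -sj sK /=; lia.
  apply: (step i (reroute s (inl (Defs.prev i)) b)); first exact: rerouteK.
  - exact: width_reroute.
  - exact: reroute_nested.
  - by rewrite /motzkin_gen_blocks (negbTE i0); exact: hook_reroute_stack.
have -> : PartitionMonoid (pairing_partition sK) = 1%g; last exact: M1.
apply: val_inj => /=; apply: (nested_id (z := z)) => // i i0 E.
by case/existsP: H; exists i; rewrite i0 E eqxx.
Qed.

End Peeling.

(** * The isomorphism *)

Theorem theorem2p13 (n : nat) (hn : 0 < n) :
  exists f : blob_monoid n -> motzkin_blob_monoid n,
    [/\ monoid_morphism f, bijective f
      & forall i : 'I_n, motzkin_val (f (blob_gen i)) = motzkin_gen i].
Proof.
have inM X : split_blobs X \in motzkin_blob_set n.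
  by apply: nested_in_motzkin => //; exact: split_mate_nested.
pose f X := MotzkinBlobMonoid (inM X); exists f; split.
- by split=> [|X Y]; apply: val_inj => /=; [exact: split_blobs1 | exact: split_blobsM].
- have fI : injective f by move=> X Y /(congr1 val) /=; exact: split_blobs_inj.
  apply: inj_card_bij => //; rewrite -(card_codom fI); apply/subset_leq_card/subsetP=> y _.
  (* The image is a submonoid containing the generators, hence one of the sets intersected in
     [motzkin_blob_set]; this gives surjectivity. *)
  pose S := [set split_blobs X | X : blob_monoid n].
  have /imsetP[X _ E] : motzkin_val y \in S.
    case: y => y /= /bigcapP; apply; apply/andP; split; last first.
      by apply/forallP=> i; rewrite -split_blobs_gen; exact: imset_f.
    apply/andP; split; first by rewrite -split_blobs1; exact: imset_f.
    apply/forall_inP=> _ /imsetP[X _ ->]; apply/forall_inP=> _ /imsetP[Y _ ->].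
    by rewrite -split_blobsM; exact: imset_f.
  by apply/codomP; exists X; apply: val_inj.
- by move=> i /=; exact: split_blobs_gen.
Qed.
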